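(* Let $\beta>0$, and for each $n\ge2$ let $m(n)\ge1$ be an integer. For each $n\ge 2$ let $(Z^{(n,0)}_k)_{1\le k\le n}$ be a random family of points in $\mathbb{C}$, and let $(Z^{(n,j)}_k)_{1\le k\le n}$, $1\le j\le m(n)$, be the zeros of its iterated circular randomized derivatives with parameter $\beta$, with empirical measures $\tilde\mu_{n,j}=\frac1n\sum_{k=1}^n\delta_{Z^{(n,j)}_k}$, $0\le j\le m(n)$ (as defined in the context). Assume that $(\tilde\mu_{n,0})_{n\ge 2}$ converges almost surely to a deterministic measure $\mu$ on $\mathbb{C}$, that $$\frac{m(n)}{n/\log n}\underset{n\to\infty}{\longrightarrow}0,$$ and that for some $B\ge0$, $$\sup_{n\ge2}n^{-B}\sup_{0\le j\le m(n)-1}\mathbb{E}\left[\min_{1\le k\le n}|Z^{(n,j)}_k|\right]<\infty.$$ Then $(\tilde\mu_{n,m(n)})_{n\ge2}$ converges almost surely to $\mu$.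
   Context: All random variables are defined on one probability space. The Gamma distribution of parameter $\beta/2$ has density $\frac{1}{\Gamma(\beta/2)}t^{\beta/2-1}e^{-t}$ on $(0,\infty)$. Iterated circular randomized derivatives: for each $n\ge2$, let $(\gamma^{(n,j)}_k)_{1\le j\le m(n),\,1\le k\le n}$ be i.i.d. Gamma random variables of parameter $\beta/2$, independent of $(Z^{(n,0)}_k)_{1\le k\le n}$. Inductively for $1\le j\le m(n)$, $(Z^{(n,j)}_k)_{1\le k\le n}$ are the zeros, counted with multiplicity, of the polynomial $$z\mapsto\sum_{k=1}^{n}\gamma^{(n,j)}_k\,(Z^{(n,j-1)}_k+z)\prod_{1\le\ell\le n,\ \ell\ne k}(z-Z^{(n,j-1)}_\ell),$$ which almost surely has degree $n$. The zeros are labelled in some measurable way depending only on $(Z^{(n,j-1)}_\ell)_\ell$ and $(\gamma^{(n,j)}_k)_k$, so that $(\gamma^{(n,j)}_k)_{1\le k\le n}$ is independent of $(Z^{(n,j-1)}_\ell)_{1\le\ell\le n}$. Almost sure convergence of random probability measures means that, almost surely, the sequence converges weakly (tested against bounded continuous functions on $\mathbb{C}$). *)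

(* Defs.v *)
From HB Require Import structures.
From mathcomp Require Import all_boot all_order all_algebra complex.
From mathcomp Require Import all_classical all_reals all_analysis.

Set Implicit Arguments.
Unset Strict Implicit.
Unset Printing Implicit Defensive.

Import Order.TTheory GRing.Theory Num.Theory.
Import numFieldTopology.Exports numFieldNormedType.Exports.
Local Open Scope classical_set_scope.
Local Open Scope complex_scope.
Local Open Scope ring_scope.

(** [R[i]^o] is [R[i]] with the topology of its modulus; [borelC R] is the same
    carrier, equipped with the Borel sigma-algebra of that topology. *)
Notation borelC R := (g_sigma_algebraType (@open R[i]^o)).

Section gamma_distribution.
Context {R : realType}.
Notation leb := (@lebesgue_measure R).

Definition Gamma_fun (a : R) : R :=
  \int[leb]_(t in `]0, +oo[) (t `^ (a - 1) * expR (- t)).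

Definition gamma_pdf (a t : R) : R :=
  if 0 < t then (Gamma_fun a)^-1 * t `^ (a - 1) * expR (- t) else 0.

Definition gamma_distributed d (T : measurableType d) (P : probability T R)
    (a : R) (X : T -> R) : Prop :=
  forall A : set R, measurable A ->
    P (X @^-1` A) = (\int[leb]_(t in A) (gamma_pdf a t)%:E)%E.

End gamma_distribution.

Section independence.
Context d d' (T : measurableType d) (T' : measurableType d') (R : realType).
Variable P : probability T R.

Definition mutually_independent (I : finType) (X : I -> T -> T') : Prop :=
  forall (J : {set I}) (B : I -> set T'), (forall i, measurable (B i)) ->
    P (\bigcap_(i in [set` J]) (X i @^-1` B i)) =
    (\prod_(i in J) P (X i @^-1` B i))%E.

Definition sigma_generated (I : Type) (X : I -> T -> T') : set_system T :=
  <<s \bigcup_i preimage_set_system setT (X i) measurable >>.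

Definition independent_systems (F G : set_system T) : Prop :=
  forall A B, F A -> G B -> P (A `&` B) = (P A * P B)%E.

End independence.

Section weak_convergence.
Context {R : realType}.

Definition empirical n (z : n.-tuple (borelC R)) :
    {measure set (borelC R) -> \bar R} :=
  mscale (n%:R^-1)%:nng (msum (fun k => \d_(z`_k : borelC R)) n).

(** [mu] is not required to be a probability: [f = 1] forces its mass to be the
    limit of the masses of [nu n]. *)
Definition weak_cvg (nu : nat -> {measure set (borelC R) -> \bar R})
    (mu : {measure set (borelC R) -> \bar R}) : Prop :=
  forall f : R[i]^o -> R, continuous f -> (exists M, forall z, `|f z| <= M) ->
    (\int[nu n]_z (f z)%:E)%E @[n --> \oo] --> (\int[mu]_z (f z)%:E)%E.

End weak_convergence.

Section circular_derivatives.
Context {R : realType}.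

Definition circular_poly n (z : n.-tuple R[i]) (g : n.-tuple R) :
    {poly R[i]} :=
  \sum_(k < n) ((tnth g k)%:C)%:P * ((tnth z k)%:P + 'X) *
    \prod_(l < n | l != k) ('X - (tnth z l)%:P).

(** As [mup x 0 = 0] for all [x], this fails for [p = 0] as soon as [n > 0];
    hence it entails that [p] has degree [n]. *)
Definition zeros_with_multiplicity n (p : {poly R[i]}) (z : n.-tuple R[i]) :
    Prop :=
  forall x, mup x p = count_mem x z.

(** For [n > 0] the initial value of the iterated minimum is one of its terms. *)
Definition min_modulus n (z : n.-tuple R[i]) : R :=
  \big[Num.min/ComplexField.Normc.normc z`_0]_(k < n) ComplexField.Normc.normc (tnth z k).

(** The [j]-th derivative is [Z j] and its weights are [g j], for
    [1 <= j <= m]; [g 0] and the variables with [j > m] are unconstrained.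
    The map [L] is the measurable labelling of the zeros; both it and the zeros
    are prescribed almost surely only, since the polynomial may have degree
    smaller than [n] on a negligible event. *)
Definition iterated_circular_derivatives d (T : measurableType d)
    (P : probability T R) (beta : R) (n m : nat)
    (Z : nat -> {RV P >-> n.-tuple (borelC R)})
    (g : nat -> {RV P >-> n.-tuple R}) : Prop :=
  let weight (i : 'I_m * 'I_n) (w : T) := tnth (g i.1.+1 w) i.2 in
  [/\ forall i, gamma_distributed P (beta / 2) (weight i),
      mutually_independent P weight,
      independent_systems P
        (sigma_generated weight)
        (sigma_generated (fun (k : 'I_n) w => tnth (Z 0%N w) k)) &
      forall j, (j < m)%N ->
        (exists2 L : n.-tuple (borelC R) * n.-tuple R -> n.-tuple (borelC R),
           measurable_fun setT L &
           {ae P, forall w, Z j.+1 w = L (Z j w, g j.+1 w)}) /\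
        {ae P, forall w, zeros_with_multiplicity
           (circular_poly (Z j w) (g j.+1 w)) (Z j.+1 w)}].

End circular_derivatives.

(* Main.v *)
Require Import Defs.
From HB Require Import structures.
From mathcomp Require Import all_boot all_order all_algebra complex.
From mathcomp Require Import all_classical all_reals all_analysis.
From mathcomp Require Import measurable_realfun ring lra zify.

Import Order.TTheory GRing.Theory Num.Theory.
Import numFieldTopology.Exports numFieldNormedType.Exports.
Local Open Scope classical_set_scope.
Local Open Scope ring_scope.

(** Let [U z] be the sum of [ln |z - Z_k|] over the current zeros. At a point
    [z] off the zeros, one circular derivative multiplies the product of the
    [|z - Z_k|] by [|S| / sum_k gamma_k], where [S] is the sum of the
    [gamma_k * (z + Z_k) / (z - Z_k)]; so it adds the logarithm of that ratio to
    [U z] ([circular_derivative_modulus]). When [z] is not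
    polynomially close to any [Z_k] nor to one given [- Z_k], the coefficients
    [(z + Z_k) / (z - Z_k)] are at most polynomially large and one of them is at
    least polynomially small. Hence the ratio is at most polynomially large. It
    is also at least polynomially small outside an event of small probability,
    because [S] is an affine function of one Gamma variable that is independent
    of the other weights and of the zeros ([near_critical_probability]). Each
    derivative thus moves [U z] by [O (ln n)], and [m n] of them by
    [O (m n * ln n) = o n] ([log_potential_all_steps]): the normalized
    logarithmic potentials of the first and last empirical measures have the
    same limit.

    Potentials are compared on finite sets only. For the [n] points [s] of the
    circle of centre [c] and radius [r] with [(s - c) ^+ n = r ^+ n], the product
    of the [w - s] is [(w - c) ^+ n - r ^+ n], so the average of [ln |w - s|] is
    [ln (max r |w - c|)] up to [O (ln n / n)] when [|w - c|] is not
    polynomially close to [r] ([circle_log_average]). There are more candidate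
    radii near a given [r0] than values [|w - c|] to avoid, so one radius suits
    all zeros of all derivatives ([pigeonhole_radius]); a union bound over the
    polynomially many points of all candidate circles and the Borel-Cantelli
    lemma then give, almost surely, that the averages of [ln (max r0 |w - c|)]
    under the first and last empirical measures have a difference tending to
    [0] ([ae_average_truncated_log_cvg]).

    A difference of two such functions with the same centre is a compactly
    supported tent. Sums of translated tents over a fine square lattice are
    almost constant ([sum_window_near_mass]), so that every nonnegative bounded
    continuous function is the pointwise limit of combinations of tents lying
    below it ([tent_sum_le], [tent_sum_cvg]). This bounds the lower limit of its
    averages; applied to [M + f] and [M - f] it gives the weak convergence
    ([weak_cvg_from_tents]). *)

(** * Modulus, topology and Borel sets of the complex plane *)

Local Notation nc := (@ComplexField.Normc.normc _).

Section complex_plane.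
Context (R : realType).
Implicit Types (z w : R[i]) (f : R[i] -> R).

Lemma normc_ge0 z : 0 <= nc z.
Proof. by case: z => x y; exact: sqrtr_ge0. Qed.

Lemma normr_normc z : `|z| = (nc z)%:C%C.
Proof. by []. Qed.

Lemma normc_eq0 z : (nc z == 0) = (z == 0).
Proof.
apply/eqP/eqP => [|->]; [exact: ComplexField.Normc.eq0_normc|exact: ComplexField.Normc.normc0].
Qed.

Lemma normc_gt0 z : (0 < nc z) = (z != 0).
Proof. by rewrite lt_neqAle normc_ge0 andbT eq_sym normc_eq0. Qed.

Lemma ler_normcD z w : nc (z + w) <= nc z + nc w.
Proof. exact: le_normcD. Qed.

Lemma normcB z w : nc (z - w) = nc (w - z).
Proof. by rewrite -normcN opprB. Qed.

Lemma ler_normcB z w : nc z - nc w <= nc (z - w).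
Proof. by rewrite lerBlDr; have := ler_normcD (z - w) w; rewrite subrK. Qed.

Lemma ler_dist_normc z w : `|nc z - nc w| <= nc (z - w).
Proof. by rewrite ler_norml ler_normcB lerNl opprB normcB ler_normcB. Qed.

Lemma normcX z n : nc (z ^+ n) = nc z ^+ n.
Proof.
elim: n => [|n IH]; first by rewrite !expr0 ComplexField.Normc.normc1.
by rewrite !exprS ComplexField.Normc.normcM IH.
Qed.

Lemma normc_prod (I : Type) (r : seq I) (p : pred I) (F : I -> R[i]) :
  nc (\prod_(i <- r | p i) F i) = \prod_(i <- r | p i) nc (F i).
Proof.
elim/big_ind2: _ => // [|x x' y y' <- <-]; first exact: ComplexField.Normc.normc1.
exact: ComplexField.Normc.normcM.
Qed.

Lemma ler_normc_sum (I : Type) (r : seq I) (p : pred I) (F : I -> R[i]) :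
  nc (\sum_(i <- r | p i) F i) <= \sum_(i <- r | p i) nc (F i).
Proof.
elim/big_ind2: _ => //; first by rewrite ComplexField.Normc.normc0.
by move=> x x' y y' h h'; apply: le_trans (ler_normcD _ _) _; exact: lerD.
Qed.

Lemma normc_real (x : R) : nc x%:C%C = `|x|.
Proof. by rewrite /= expr0n /= addr0 sqrtr_sqr. Qed.

Lemma ler_abs_Re z : `|complex.Re z| <= nc z.
Proof.
by case: z => x y /=; rewrite -sqrtr_sqr ler_wsqrtr// lerDl sqr_ge0.
Qed.

Lemma ler_abs_Im z : `|complex.Im z| <= nc z.
Proof.
by case: z => x y /=; rewrite -sqrtr_sqr ler_wsqrtr// lerDr sqr_ge0.
Qed.

(** The balls of the topology have complex radii; the radii of nonempty balls
    are real. *)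
Lemma continuous_complexP f : continuous (f : R[i]^o -> R) <->
  forall z e, 0 < e -> exists2 dl : R, 0 < dl &
    forall w, nc (w - z) < dl -> `|f w - f z| < e.
Proof.
split=> [cf z e e0|H z].
  have /cvgrPdist_lt/(_ e e0) := cf z.
  move=> /nbhs_ballP[/= dl dl0 Hdl].
  have dlR : dl = (complex.Re dl)%:C%C by rewrite RRe_real// gtr0_real.
  move: dl0 Hdl; rewrite dlR ltcR => dl0 Hdl.
  exists (complex.Re dl) => // w wz; rewrite distrC; apply: Hdl.
  by rewrite /ball/= normr_normc ltcR normcB.
have FF : Filter (nbhs (z : R[i]^o)) by exact: nbhs_filter.
apply/(@cvgrPdist_lt R R _ (nbhs (z : R[i]^o)) FF) => e e0; have [dl dl0 Hdl] := H z e e0.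
apply/nbhs_ballP; exists dl%:C%C => /=; first by rewrite ltcR.
by move=> w; rewrite /ball/= normr_normc ltcR normcB distrC; exact: Hdl.
Qed.

Lemma continuous_complex_lipschitz f (K : R) :
  (forall z w, `|f w - f z| <= K * nc (w - z)) -> continuous (f : R[i]^o -> R).
Proof.
move=> fK; apply/continuous_complexP => z e e0.
have K0 : 0 <= K by have := fK 0 1; rewrite subr0 ComplexField.Normc.normc1 mulr1; exact: le_trans.
exists (e / (K + 1)); first by rewrite divr_gt0//; lra.
move=> w wz; apply: le_lt_trans (fK _ _) _.
move: wz; rewrite ltr_pdivlMr; last lra.
by have := normc_ge0 (w - z); nra.
Qed.

Lemma continuous_measurable_complex f : continuous (f : R[i]^o -> R) ->
  measurable_fun [set: borelC R] f.
Proof.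
move=> cf; apply: (measurability _ (RGenOpens.measurableE R)).
move=> _ [_ [a [b ->] <-]]; rewrite setTI; apply: sub_sigma_algebra.
by apply: open_comp => // z _; exact: cf.
Qed.

Lemma measurable_Re : measurable_fun [set: borelC R] (@complex.Re R).
Proof.
apply: continuous_measurable_complex; apply: (@continuous_complex_lipschitz _ 1) => z w.
by rewrite -raddfB mul1r; exact: ler_abs_Re.
Qed.

Lemma measurable_Im : measurable_fun [set: borelC R] (@complex.Im R).
Proof.
apply: continuous_measurable_complex; apply: (@continuous_complex_lipschitz _ 1) => z w.
by rewrite -raddfB mul1r; exact: ler_abs_Im.
Qed.

End complex_plane.

(** * Tails and small balls of the Gamma distribution *)

Section gamma_bounds.
Context (R : realType) (a : R).
Hypothesis a0 : 0 < a.
Notation leb := (@lebesgue_measure R).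

Lemma powR_expRN_bound (b : R) : 0 < b ->
  exists2 K : R, 0 < K & forall t : R, 0 < t -> t `^ b * expR (- t) <= K.
Proof.
move=> b0; exists (expR (b * (ln b - 1))); first exact: expR_gt0.
move=> t t0; rewrite /powR gt_eqF// -expRD ler_expR.
have tb0 : 0 < t / b by exact: divr_gt0.
have : ln (t / b) <= t / b - 1.
  by rewrite -{1}(subrKC 1 (t / b)) le_ln1Dx// -subr_gt0; lra.
rewrite ln_div ?posrE// => h.
have : b * (ln t - ln b) <= b * (t / b - 1) by rewrite ler_pM2l.
by rewrite [X in _ <= X]mulrBr mulrCA divff ?gt_eqF// !mulr1 => h2; lra.
Qed.

Lemma Gamma_fun_ge0 : 0 <= Gamma_fun a.
Proof.
by apply: Rintegral_ge0 => t _; rewrite mulr_ge0 ?powR_ge0 ?expR_ge0.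
Qed.

Lemma gamma_pdf_ge0 t : 0 <= gamma_pdf a t.
Proof.
rewrite /gamma_pdf; case: ifP => // _.
by rewrite !mulr_ge0 ?powR_ge0 ?expR_ge0 ?invr_ge0 ?Gamma_fun_ge0.
Qed.

Lemma gamma_pdfE t : 0 < t ->
  gamma_pdf a t = (Gamma_fun a)^-1 * (t `^ a * expR (- t)) / t.
Proof.
move=> t0; rewrite /gamma_pdf t0 powRB ?(gt_eqF t0) ?implybT// powRr1 ?ltW//.
by rewrite !mulrA [LHS]mulrAC.
Qed.

Lemma measurable_gamma_pdf : measurable_fun setT (gamma_pdf a).
Proof.
apply: measurable_fun_ifT => //.
- exact: measurable_fun_ltr.
- have mp : measurable_fun [set: R] (fun t : R => t `^ (a - 1)) by exact: measurable_powR.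
  have mE : measurable_fun [set: R] (fun t : R => expR (- t)).
    by apply: measurableT_comp => //; exact: measurable_expR.
  exact: (measurable_funM (measurable_funM (measurable_cst _) mp) mE).
Qed.

Context d (T : measurableType d) (P : probability T R).

Lemma gamma_distributed_interval (X : T -> R) u v K :
  gamma_distributed P a X -> u <= v ->
  (forall t, u < t -> t <= v -> gamma_pdf a t <= K) ->
  (P (X @^-1` `]u, v]) <= (K * (v - u))%:E)%E.
Proof.
move=> gX uv hK; rewrite gX//.
apply: (@le_trans _ _ (\int[leb]_(t in `]u, v]) (cst K%:E t))%E).
  apply: ge0_le_integral => //=.
  - by move=> t _; rewrite lee_fin gamma_pdf_ge0.
  - apply/measurable_EFinP; exact: measurable_funTS measurable_gamma_pdf.
  - by move=> t; rewrite in_itv/= => /andP[h1 h2]; rewrite lee_fin hK.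
rewrite integral_cst//= lebesgue_measure_itv/= lte_fin.
case: ltP => [_|vu]; first by rewrite -EFinD -EFinM.
by rewrite mule0 lee_fin (_ : v - u = 0) ?mulr0//; apply/eqP; rewrite subr_eq0 eq_le uv vu.
Qed.

Lemma gamma_distributed_le0 (X : T -> R) : gamma_distributed P a X ->
  P (X @^-1` `]-oo, 0]) = 0%E.
Proof.
move=> gX; rewrite gX// integral0_eq// => t /=; rewrite in_itv/= => t0.
by rewrite /gamma_pdf ltNge t0.
Qed.

(** The mass of [`]y, 2 * y]] is at most the supremum of [t * gamma_pdf a t] on
    it, whatever the scale [y]; a geometric decay of these suprema sums up. *)
Lemma gamma_distributed_dyadic (X : T -> R) (y : nat -> R) (A : set R) (K q : R) :
  gamma_distributed P a X -> measurable_fun setT X -> measurable A -> 0 < q < 1 ->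
  (forall i, 0 < y i) ->
  A `<=` \bigcup_i `]y i, (2 * y i)%R]%classic ->
  (forall i t, y i < t -> t <= 2 * y i -> t * gamma_pdf a t <= K * q ^+ i) ->
  (P (X @^-1` A) <= (K / (1 - q))%:E)%E.
Proof.
move=> gX mX mA /andP[q0 q1] y0 cov hK.
have mXp B : measurable B -> measurable (X @^-1` B).
  by move=> mB; rewrite -[X in measurable X]setTI; exact: mX.
have K0 : 0 <= K.
  have := hK 0%N (2 * y 0%N); rewrite expr0 mulr1 => h.
  apply: le_trans (h _ _) => //; last by have := y0 0%N; lra.
  by rewrite mulr_ge0 ?gamma_pdf_ge0// mulr_ge0// ltW.
apply: (@le_trans _ _ (\sum_(i <oo) P (X @^-1` `]y i, (2 * y i)%R]))%E).
  apply: measure_sigma_subadditive => //; last by rewrite -preimage_bigcup; exact: preimage_subset.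
  + by move=> i; exact: mXp.
  + exact: mXp.
apply: (@le_trans _ _ (\sum_(i <oo) (K * q ^+ i)%:E)%E).
  apply: lee_nneseries => [i _ _|i _]; first exact: measure_ge0.
  have -> : K * q ^+ i = (K * q ^+ i) / y i * (2 * y i - y i).
    by field; rewrite gt_eqF.
  apply: gamma_distributed_interval => //; first by have := y0 i; lra.
  move=> t h1 h2; rewrite ler_pdivlMr//; apply: le_trans (hK i t h1 h2).
  by rewrite mulrC ler_wpM2r ?gamma_pdf_ge0// ltW.
apply: lime_le.
  by apply: is_cvg_nneseries => i _ _; rewrite lee_fin mulr_ge0// exprn_ge0// ltW.
apply: nearW => i; rewrite sumEFin lee_fin.
have := @geometric_le_lim _ i K q K0 q0; rewrite gtr0_norm// => /(_ q1).
by rewrite /series /=.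
Qed.

Lemma mul_gamma_pdf_bound : exists2 K : R, 0 < K &
  forall t, 0 < t -> t * gamma_pdf a t <= K.
Proof.
have [K K0 hK] := powR_expRN_bound a a0.
exists ((Gamma_fun a)^-1 * K + 1).
  by rewrite ltr_wpDl// mulr_ge0 ?invr_ge0 ?Gamma_fun_ge0// ltW.
move=> t t0; rewrite gamma_pdfE// mulrC mulfVK ?gt_eqF//.
rewrite (@le_trans _ _ ((Gamma_fun a)^-1 * K)) ?lerDl//.
by rewrite ler_wpM2l ?hK// invr_ge0 Gamma_fun_ge0.
Qed.

Lemma pow2_unbounded (x : R) : exists n, x < 2 ^+ n.
Proof.
exists (Num.truncn `|x|).+1.
apply: le_lt_trans (ler_norm x) _.
apply: lt_trans (truncnS_gt _) _; rewrite -natrX ltr_nat; exact: ltn_expl.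
Qed.

(** On the intervals that double from [x] on, [t * gamma_pdf a t] is at most a
    multiple of [1 / t], because [t `^ (a + 1) * expR (- t)] is bounded. *)
Lemma gamma_tail : exists2 K : R, 0 < K & forall (X : T -> R) (x : R),
  gamma_distributed P a X -> measurable_fun setT X -> 0 < x ->
  (P (X @^-1` `]x, +oo[) <= (K / x)%:E)%E.
Proof.
have a10 : 0 < a + 1 by rewrite addr_gt0.
have [K K0 hK] := powR_expRN_bound (a + 1) a10.
pose K1 := (Gamma_fun a)^-1 * K.
have K10 : 0 <= K1 by rewrite mulr_ge0 ?invr_ge0 ?Gamma_fun_ge0// ltW.
have hK1 t : 0 < t -> t * gamma_pdf a t <= K1 / t.
  move=> t0; rewrite gamma_pdfE// ler_pdivlMr//.
  have -> : t * ((Gamma_fun a)^-1 * (t `^ a * expR (- t)) / t) * t =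
      (Gamma_fun a)^-1 * (t `^ (a + 1) * expR (- t)).
    rewrite powRD ?(gt_eqF t0) ?implybT// powRr1 ?ltW//; set g := _^-1.
    by field; rewrite gt_eqF.
  by rewrite ler_wpM2l ?hK// invr_ge0 Gamma_fun_ge0.
clearbody K1.
exists (2 * K1 + 1); first by rewrite ltr_wpDl// mulr_ge0.
move=> X x gX mX x0.
apply: le_trans (gamma_distributed_dyadic X (fun i => x * 2 ^+ i) _ (K1 / x) (2^-1)
  gX mX _ _ _ _ _) _ => //.
- by apply/andP; split; lra.
- by move=> i; rewrite mulr_gt0// exprn_gt0.
- move=> t /=; rewrite in_itv/= andbT => xt.
  have t0 := lt_trans x0 xt.
  have [m tm] := pow2_unbounded (t / x).
  have [[|i] xm im] := ex_minnP (ex_intro (fun n => t / x <= 2 ^+ n) m (ltW tm)).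
    by move: xm; rewrite expr0 ler_pdivrMr// mul1r leNgt xt.
  exists i => //=; rewrite in_itv/=; apply/andP; split.
    rewrite mulrC -ltr_pdivlMr// ltNge; apply/negP => h.
    by have := im _ h; rewrite ltnn.
  by rewrite mulrCA -exprS mulrC -ler_pdivrMr.
- move=> i t h1 h2.
  have xi0 : 0 < x * 2 ^+ i by rewrite mulr_gt0// exprn_gt0.
  have t0 : 0 < t by apply: lt_trans h1.
  apply: le_trans (hK1 t t0) _; rewrite -mulrA ler_wpM2l//.
  by rewrite exprVn -invfM lef_pV2 ?posrE// ltW.
- rewrite lee_fin mulrC (_ : (1 - 2^-1)^-1 = 2); last by field; lra.
  by rewrite mulrA ler_pM2r ?invr_gt0//; lra.
Qed.

(** Here the dyadic intervals shrink to [0], where [t * gamma_pdf a t] is at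
    most a multiple of [t `^ a]. *)
Lemma gamma_near0 : exists2 K : R, 0 < K & forall (X : T -> R) (s : R),
  gamma_distributed P a X -> measurable_fun setT X -> 0 < s ->
  (P (X @^-1` `]-oo, s]) <= (K * s `^ a)%:E)%E.
Proof.
pose K1 := (Gamma_fun a)^-1.
have K10 : 0 <= K1 by rewrite invr_ge0 Gamma_fun_ge0.
pose q := (2^-1 : R) `^ a.
have q0 : 0 < q by rewrite powR_gt0; lra.
have q1 : q < 1.
  rewrite /q /powR gt_eqF ?invr_gt0// -[X in _ < X]expR0 ltr_expR pmulr_rlt0//.
  apply: ln_lt0. apply/andP; split; lra.
have qq : 0 < 1 - q by rewrite subr_gt0.
exists (K1 / (1 - q) + 1); first by rewrite ltr_wpDl// mulr_ge0// invr_ge0 ltW.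
move=> X s gX mX s0.
have mXp B : measurable B -> measurable (X @^-1` B).
  by move=> mB; rewrite -[X in measurable X]setTI; exact: mX.
have -> : `]-oo, s]%classic = `]-oo, 0] `|` `]0, s] :> set R.
  apply/seteqP; split => t /=; rewrite !in_itv/=.
    by move=> ts; case: (leP t 0) => h; [left|right].
  by move=> [/le_trans|/andP[]//]; apply; exact: ltW.
rewrite preimage_setU; apply: le_trans (measureU2 _ _ _) _; try exact: mXp.
rewrite [X in (X + _)%E]gamma_distributed_le0// add0e.
apply: le_trans (gamma_distributed_dyadic X (fun i => s * 2^-1 ^+ i.+1) _ (K1 * s `^ a) q
  gX mX _ _ _ _ _) _ => //.
- by rewrite q0.
- by move=> i; rewrite mulr_gt0// exprn_gt0; lra.
- move=> t /=; rewrite in_itv/= => /andP[t0 ts].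
  have [m tm] := pow2_unbounded (s / t).
  have [[|i] xm im] := ex_minnP (ex_intro (fun n => s / t < 2 ^+ n) m tm).
    by move: xm; rewrite expr0 ltr_pdivrMr// mul1r ltNge ts.
  exists i => //=; rewrite in_itv/= exprVn; apply/andP; split.
    by rewrite ltr_pdivrMr ?exprn_gt0// mulrC -ltr_pdivrMr.
  have -> : 2 * (s * (2 ^+ i.+1)^-1) = s / 2 ^+ i.
    by rewrite exprS; field; rewrite ?expf_neq0//.
  rewrite ler_pdivlMr ?exprn_gt0// mulrC -ler_pdivlMr// leNgt; apply/negP => h.
  by have := im _ h; rewrite ltnn.
- move=> i t h1 h2.
  have si0 : 0 < s * 2^-1 ^+ i.+1 by rewrite mulr_gt0// exprn_gt0; lra.
  have t0 : 0 < t by apply: lt_trans h1.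
  rewrite gamma_pdfE// mulrC mulfVK ?gt_eqF// -/K1 -mulrA ler_wpM2l//.
  apply: (@le_trans _ _ (t `^ a)).
    by rewrite ler_piMr ?powR_ge0// -[X in _ <= X]expR0 ler_expR oppr_le0 ltW.
  have -> : s `^ a * q ^+ i = (2^-1 ^+ i * s) `^ a.
    rewrite powRM ?exprn_ge0 ?invr_ge0 ?(ltW s0)// mulrC; congr (_ * _).
    by rewrite -[X in _ = X `^ _]powR_mulrn ?invr_ge0// -powRrM mulrC powRrM powR_mulrn ?powR_ge0.
  have h3 : t <= 2^-1 ^+ i * s.
    by apply: le_trans h2 _; rewrite exprS; set y := _ ^+ i; lra.
  rewrite ge0_ler_powR ?nnegrE//; try exact: ltW.
  by rewrite (le_trans (ltW t0)).
- rewrite lee_fin mulrAC ler_wpM2r ?powR_ge0//; lra.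
Qed.

(** The density may be unbounded near [0]. Beyond the threshold [s] it is at
    most a multiple of [1 / s], and the mass below [s] is that of
    [gamma_near0]; leaving [s] free avoids a case distinction on [a]. *)
Lemma gamma_small_ball : exists2 K : R, 0 < K & forall (X : T -> R) (s u r : R),
  gamma_distributed P a X -> measurable_fun setT X -> 0 < s -> 0 < r ->
  (P (X @^-1` `[u, (u + r)%R]) <= (K * (s `^ a + r / s))%:E)%E.
Proof.
have [K1 K10 h1] := gamma_near0.
have [K2 K20 h2] := mul_gamma_pdf_bound.
exists (K1 + 2 * K2); first by rewrite addr_gt0// mulr_gt0.
move=> X s u r gX mX s0 r0.
have mXp B : measurable B -> measurable (X @^-1` B).
  by move=> mB; rewrite -[X in measurable X]setTI; exact: mX.
(* Starting at [u - r] makes the interval half-open while still covering [u]. *)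
pose v := Num.max s (u - r).
have sv : s <= v by rewrite /v le_max lexx.
have uv : u - r <= v by rewrite /v le_max lexx orbT.
have sub : `[u, (u + r)%R] `<=` `]-oo, s] `|` `]v, (v + 2 * r)%R].
  move=> t /=; rewrite !in_itv/= => /andP[ut tu].
  case: (leP t s) => ts; [left=>//|right].
  apply/andP; split; last lra.
  by rewrite /v gt_max ts/=; lra.
apply: (@le_trans _ _ (P (X @^-1` `]-oo, s] `|` X @^-1` `]v, (v + 2 * r)%R]))).
  apply: le_measure; rewrite ?inE; [exact: mXp|apply: measurableU; exact: mXp|].
  by rewrite -preimage_setU; exact: preimage_subset.
apply: le_trans (measureU2 _ _ _) _; try exact: mXp.
apply: (@le_trans _ _ ((K1 * s `^ a)%:E + (K2 / s * (v + 2 * r - v))%:E)%E).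
  apply: leeD; first exact: h1.
  apply: gamma_distributed_interval => //; first lra.
  move=> t vt _; have st := le_lt_trans sv vt.
  rewrite ler_pdivlMr// (le_trans _ (h2 t (lt_trans s0 st)))// mulrC.
  by rewrite ler_wpM2r ?gamma_pdf_ge0// ltW.
rewrite -EFinD lee_fin.
have p0 : 0 <= s `^ a by exact: powR_ge0.
have q0 : 0 < r / s by rewrite divr_gt0.
rewrite (_ : K2 / s * (v + 2 * r - v) = 2 * K2 * (r / s)); last by field; rewrite gt_eqF.
by nra.
Qed.

End gamma_bounds.

(** * Independence of one weight from the past *)

Section independence_of_one_weight.
Context d d1 d2 (T : measurableType d) (T1 : measurableType d1)
  (T2 : measurableType d2) (R : realType) (P : probability T R).
Context (I : finType) (n : nat) (X : I -> T -> T1) (Y : 'I_n -> T -> T2).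
Hypothesis mX : forall i, measurable_fun setT (X i).
Hypothesis mY : forall k, measurable_fun setT (Y k).
Hypothesis indX : mutually_independent P X.
Hypothesis indXY :
  independent_systems P (sigma_generated X) (sigma_generated Y).
Variable i0 : I.

(** A pi-system that generates the sigma-algebra of [Y] and of all [X i] with
    [i] other than [i0]. *)
Definition rest_system : set_system T :=
  [set G | exists A, exists B : I -> set T1,
     [/\ sigma_generated Y A, forall i, measurable (B i) &
       G = A `&` \bigcap_(i in [set` [set~ i0]%SET]) (X i @^-1` B i)]].

Lemma measurable_sigma_generated (J : Type) (d3 : measure_display)
    (T3 : measurableType d3) (W : J -> T -> T3) A :
  (forall j, measurable_fun setT (W j)) -> sigma_generated W A -> measurable A.
Proof.
move=> mW; apply: smallest_sub; first exact: sigma_algebra_measurable.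
move=> _ [j _ [B mB <-]]; exact: mW.
Qed.

Lemma sigma_generated_preimage (J : Type) (d3 : measure_display)
    (T3 : measurableType d3) (W : J -> T -> T3) j B :
  measurable B -> sigma_generated W (W j @^-1` B).
Proof.
by move=> mB; apply: sub_sigma_algebra; exists j => //; exists B => //; rewrite setTI.
Qed.

Lemma measurable_bigcap_preimage (J : {set I}) (B : I -> set T1) :
  (forall i, measurable (B i)) ->
  measurable (\bigcap_(i in [set` J]) (X i @^-1` B i)).
Proof.
move=> mB; apply: fin_bigcap_measurable => // i _.
by rewrite -[X in measurable X]setTI; exact: mX.
Qed.

Lemma sigma_generated_bigcap (J : {set I}) (B : I -> set T1) :
  (forall i, measurable (B i)) ->
  sigma_generated X (\bigcap_(i in [set` J]) (X i @^-1` B i)).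
Proof.
move=> mB.
pose S : measurableType _ :=
    g_sigma_algebraType (\bigcup_i preimage_set_system setT (X i) measurable).
suff : @measurable _ S (\bigcap_(i in [set` J]) (X i @^-1` B i)) by [].
apply: fin_bigcap_measurable => // i _.
exact: sigma_generated_preimage.
Qed.

Lemma independent_weight_rest_generator B G : measurable B -> rest_system G ->
  P (X i0 @^-1` B `&` G) = (P (X i0 @^-1` B) * P G)%E.
Proof.
move=> mB [A [C [sA mC ->]]].
pose C' i := if i == i0 then B else C i.
have mC' i : measurable (C' i) by rewrite /C'; case: ifP.
have E1 : X i0 @^-1` B `&` (A `&` \bigcap_(i in [set` [set~ i0]%SET]) (X i @^-1` C i)) =
   (\bigcap_(i in [set` [set: I]%SET]) (X i @^-1` C' i)) `&` A.
  apply/seteqP; split => [w /= [Bw [Aw Hw]]|w /= [Hw Aw]].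
    split=> // i _; rewrite /C' /=; have [->//|ii0] := eqVneq i i0.
    by have := Hw i; rewrite /mkset !inE => /(_ ii0).
  split; first by have := Hw i0; rewrite /C' eqxx /mkset inE; exact.
  split => // i /=; rewrite !inE => ii0.
  by have := Hw i; rewrite /C' (negbTE ii0) /mkset inE; exact.
rewrite E1 indXY//; last exact: sigma_generated_bigcap.
rewrite setIC indXY//; last exact: sigma_generated_bigcap.
rewrite !indX// muleA; congr (_ * _)%E.
rewrite (bigD1 i0) ?inE//= {1}/C' eqxx; congr (_ * _)%E.
apply: eq_big => [i|i]; first by rewrite !inE.
by rewrite !inE /C' => /negbTE ->.
Qed.

Lemma rest_system_setI : setI_closed rest_system.
Proof.
move=> _ _ [A [B [sA mB ->]]] [A' [B' [sA' mB' ->]]].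
exists (A `&` A'), (fun i => B i `&` B' i); split.
- pose S : measurableType _ :=
    g_sigma_algebraType (\bigcup_i preimage_set_system setT (Y i) measurable).
  suff : @measurable _ S (A `&` A') by [].
  exact: measurableI.
- by move=> i; exact: measurableI.
- by rewrite setIACA -bigcapI.
Qed.

Lemma rest_system_measurable G : rest_system G -> measurable G.
Proof.
move=> [A [B [sA mB ->]]]; apply: measurableI.
  exact: measurable_sigma_generated sA.
exact: measurable_bigcap_preimage.
Qed.

(** The events that obey the product rule with a fixed event form a
    lambda-system, so it is enough to test them on a pi-system. *)
Lemma independent_weight_rest B G : measurable B -> <<s rest_system >> G ->
  P (X i0 @^-1` B `&` G) = (P (X i0 @^-1` B) * P G)%E.
Proof.
move=> mB.
have mXB : measurable (X i0 @^-1` B).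
  by rewrite -[X in measurable X]setTI; exact: mX.
pose H := [set G : set T | measurable G /\
  P (X i0 @^-1` B `&` G) = (P (X i0 @^-1` B) * P G)%E].
suff HH : <<s rest_system >> `<=` H by move=> /HH[].
apply: (lambda_system_subset rest_system_setI) => //; last first.
  move=> K rK; split; first exact: rest_system_measurable.
  exact: independent_weight_rest_generator.
apply/dynkin_lambda_system; split.
- by split=> //; rewrite setIT probability_setT mule1.
- move=> K [mK PK]; split; first exact: measurableC.
  have -> : X i0 @^-1` B `&` ~` K = X i0 @^-1` B `\` (X i0 @^-1` B `&` K).
    by rewrite setDIr setDv set0U setDE.
  have fXB : P (X i0 @^-1` B) \is a fin_num by exact: fin_num_measure.
  have fK : P K \is a fin_num by exact: fin_num_measure.
  rewrite measureD//; last 2 first.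
    exact: measurableI.
    by rewrite ltey_eq fXB.
  have -> : X i0 @^-1` B `&` (X i0 @^-1` B `&` K) = X i0 @^-1` B `&` K.
    by rewrite setIA setIid.
  transitivity (P (X i0 @^-1` B) - P (X i0 @^-1` B) * P K)%E.
    by congr (_ - _)%E; exact: PK.
  rewrite probability_setC// muleBr ?mule1//.

- move=> F tF HF; split; first by apply: bigcup_measurable => k _; case: (HF k).
  rewrite setI_bigcupr.
  have tF' : trivIset setT (fun k => X i0 @^-1` B `&` F k).
    by apply: trivIset_setIl.
  rewrite measure_bigcup//; last by move=> k _; apply: measurableI => //; case: (HF k).
  rewrite measure_bigcup//; last by move=> k _; case: (HF k).
  have fXB : P (X i0 @^-1` B) \is a fin_num by exact: fin_num_measure.
  rewrite -(fineK fXB) -nneseriesZl//.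
  apply: eq_eseriesr => k _.
  by rewrite fineK//; case: (HF k).
Qed.

Local Notation restT := (g_sigma_algebraType rest_system).

Lemma measurable_rest_weight i : i != i0 ->
  measurable_fun setT (X i : restT -> T1).
Proof.
move=> ii0 _ B mB; rewrite setTI; apply: sub_sigma_algebra.
exists setT, (fun k => if k == i then B else setT); split.
- pose S : measurableType _ :=
    g_sigma_algebraType (\bigcup_i preimage_set_system setT (Y i) measurable).
  suff : @measurable _ S setT by [].
  exact: measurableT.
- by move=> k; case: ifP.
- rewrite setTI; apply/seteqP; split => [w /= Bw k _ /=|w /= /(_ i)/=].
    by case: eqP => [->|].
  by rewrite eqxx !inE => /(_ ii0).
Qed.

Lemma measurable_rest_initial k : measurable_fun setT (Y k : restT -> T2).
Proof.
move=> _ B mB; rewrite setTI; apply: sub_sigma_algebra.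
exists (Y k @^-1` B), (fun=> setT); split => //.
- exact: sigma_generated_preimage.
- by apply/seteqP; split => [w Bw|w []//].
Qed.

End independence_of_one_weight.

(** The random centre [c] is cut into cells of length [r]. In each cell the
    event forces [X] into a fixed interval of length [3 * r], and independence
    applies; summing over the cells replaces an integration over the law of
    [c]. *)
Lemma independent_small_ball d (T : measurableType d) (R : realType)
    (P : probability T R) (G : set_system T) (X c : T -> R) (r : R) (p : R) :
  (forall A, <<s G >> A -> measurable A) ->
  (forall B A, measurable B -> <<s G >> A ->
     P (X @^-1` B `&` A) = (P (X @^-1` B) * P A)%E) ->
  measurable_fun setT X ->
  measurable_fun setT (c : g_sigma_algebraType G -> R) ->
  0 < r ->
  (forall u, (P (X @^-1` `[u, (u + 3 * r)%R]) <= p%:E)%E) ->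
  (P [set w | (`|X w - c w| <= r)%R] <= p%:E)%E.
Proof.
move=> mG ind mX mc r0 Hp.
have p0 : (0 <= p%:E)%E by apply: le_trans (Hp 0); exact: measure_ge0.
pose F k := [set w | pickle (Num.floor (c w / r)) = k].
have mcT : measurable_fun setT c.
  by move=> _ B mB; apply: mG; exact: mc.
(* [pickle] makes the index of the cell of [c] a natural number. *)
have sF k : <<s G >> (F k).
  have [[i <-]|Fn] := pselect (exists i : int, pickle i = k); last first.
    have -> : F k = set0.
      by apply/seteqP; split => // w /= Fw; apply: Fn; exists (Num.floor (c w / r)).
    exact: (@measurable0 _ (g_sigma_algebraType G)).
  have -> : F (@pickle int i) = setT `&` c @^-1` `[i%:~R * r, (i + 1)%:~R * r[.
    rewrite setTI; apply/seteqP; split => w /=; rewrite in_itv/= -ler_pdivlMr// -ltr_pdivrMr//.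
      by move=> /(pcan_inj pickleK) <-; exact: floor_itv.
    by move=> /floor_def <-.
  by apply: mc.
have mF k : measurable (F k) by exact: mG.
set E := [set w | _].
have mE : measurable E.
  have -> : E = setT `&` (fun w => `|X w - c w|) @^-1` `]-oo, r].
    by rewrite setTI; apply/seteqP; split => w; rewrite /E /= in_itv.
  suff : measurable_fun setT (fun w => `|X w - c w|) by apply.
  by apply: measurableT_comp => //; exact: measurable_funB.
have FT : \bigcup_k F k = setT.
  by apply/seteqP; split => // w _; exists (pickle (Num.floor (c w / r))).
have tF : trivIset setT F.
  by apply/trivIsetP => i j _ _ ij; apply/seteqP; split => // w /= [Fi Fj]; move: ij; rewrite -Fi -Fj eqxx.
have -> : E = \bigcup_k (E `&` F k) by rewrite -setI_bigcupr FT setIT.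
rewrite measure_bigcup//; last 2 first.
- by move=> k _; exact: measurableI.
- exact: trivIset_setIl.
apply: (@le_trans _ _ (\sum_(0 <= k <oo | k \in [set: nat]) p%:E * P (F k))%E).
  apply: lee_nneseries => // k _.
  have [[i <-]|Fn] := pselect (exists i : int, pickle i = k); last first.
    have -> : F k = set0.
      by apply/seteqP; split => // w /= Fw; apply: Fn; exists (Num.floor (c w / r)).
    by rewrite setI0 !measure0 mule0.
  pose u := (i%:~R - 1) * r.
  apply: (@le_trans _ _ (P (X @^-1` `[u, (u + 3 * r)] `&` F (pickle i)))).
    apply: le_measure; rewrite ?inE.
    - exact: measurableI.
    - apply: measurableI => //.
      by rewrite -[X in measurable X]setTI; exact: mX.
    move=> w /= [Ew Fw]; split => //; move: Ew; rewrite /E/= in_itv/= ler_distlC.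
    move: Fw => /(pcan_inj pickleK) Fw; move: (floor_itv (c w / r)).
    rewrite Fw ler_pdivlMr// ltr_pdivrMr// intrD /u => /andP[h1 h2] /andP[h3 h4].
    by apply/andP; split; nra.
  rewrite ind//; apply: lee_wpmul2r => //; exact: measure_ge0.
rewrite nneseriesZl//.
rewrite -measure_bigcup// FT [X in (_ * X <= _)%E](_ : _ = 1%E) ?mule1//.
exact: probability_setT.
Qed.

(** * One circular derivative, seen from a point *)

Section circular_step.
Context (R : realType).
Local Open Scope complex_scope.

Definition circular_weight (x z : R[i]) : R[i] := (x + z) / (x - z).

(** The value at [x] of the circular polynomial divided by the monic polynomial
    with zeros [z]. *)
Definition circular_sum {n} (x : R[i]) (z : n.-tuple R[i]) (g : n.-tuple R) : R[i] :=
  \sum_(k < n) (tnth g k)%:C * circular_weight x (tnth z k).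

(** The logarithmic potential of [n] times the empirical measure, with the sign
    for which it is subharmonic. *)
Definition log_potential {n} (x : R[i]) (z : n.-tuple R[i]) : R :=
  \sum_(k < n) ln (nc (x - tnth z k)).

Lemma horner_circular_poly n (x : R[i]) (z : n.-tuple R[i]) (g : n.-tuple R) :
  (forall k, x != tnth z k) ->
  (circular_poly z g).[x] = circular_sum x z g * \prod_(k < n) (x - tnth z k).
Proof.
move=> xz; rewrite horner_sum mulr_suml; apply: eq_bigr => k _.
rewrite !hornerM hornerD !hornerC hornerX horner_prod [in RHS](bigD1 k)//=.
rewrite (eq_bigr (fun l => x - tnth z l)); last by move=> l _; rewrite hornerXsubC.
rewrite /circular_weight -!mulrA; congr (_ * _); rewrite [_ + x]addrC; congr (_ * _).
by rewrite mulrA mulVf ?mul1r// subr_eq0.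
Qed.

Lemma size_prod_XsubC_neq n (z : n.-tuple R[i]) (k : 'I_n) :
  size (\prod_(l < n | l != k) ('X - (tnth z l)%:P)) = n.
Proof.
have := size_prod_XsubC (index_enum 'I_n) (fun l => tnth z l).
rewrite (bigD1 k)//= size_monicM ?monicXsubC ?monic_neq0 ?monic_prod_XsubC//.
by rewrite size_XsubC /= /index_enum -enumT size_enum_ord => -[].
Qed.

Lemma lead_coef_circular_poly n (z : n.-tuple R[i]) (g : n.-tuple R) :
  \sum_(k < n) tnth g k != 0 ->
  lead_coef (circular_poly z g) = (\sum_(k < n) tnth g k)%:C.
Proof.
move=> g0.
have g0' : (\sum_(k < n) tnth g k)%:C != 0 :> R[i] by rewrite eq_complex/= eqxx andbT.
have -> : circular_poly z g =
    (\sum_(k < n) tnth g k)%:C *: \prod_(k < n) ('X - (tnth z k)%:P) +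
    \sum_(k < n) ((tnth g k)%:C * (tnth z k *+ 2)) *:
      \prod_(l < n | l != k) ('X - (tnth z l)%:P).
  rewrite rmorph_sum scaler_suml -big_split; apply: eq_bigr => k _ /=.
  rewrite [in RHS](bigD1 k)//= -!mul_polyC polyCM -!mulrA -mulrDr; congr (_ * _).
  by rewrite -mulrDl; congr (_ * _); rewrite polyCMn; ring.
rewrite lead_coefDl.
  by rewrite lead_coefZ (monicP (monic_prod_XsubC _ _ _)) mulr1.
rewrite size_scale// [X in (_ < X)%N](_ : _ = n.+1) ?ltnS; last first.
  by rewrite size_prod_XsubC /index_enum -enumT size_enum_ord.
apply: leq_trans (size_sum _ _ _) _; apply/bigmax_leqP_seq => k _ _.
by apply: leq_trans (size_scale_leq _ _) _; rewrite size_prod_XsubC_neq.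
Qed.

Lemma mup_prod_XsubC (r : seq R[i]) x :
  mup x (\prod_(y <- r) ('X - y%:P)) = count_mem x r.
Proof.
elim: r => [|y r IH]; first by rewrite big_nil mupNroot// rootE hornerC oner_neq0.
rewrite big_cons mupM ?polyXsubC_eq0 ?monic_neq0 ?monic_prod_XsubC ?monicXsubC//= IH.
by rewrite -[X in mup _ X]expr1 mup_XsubCX eq_sym; case: eqP.
Qed.

(** Over an algebraically closed field the root multiplicities are those of the
    linear factors. *)
Lemma zeros_with_multiplicity_prod n (p : {poly R[i]}) (z : n.-tuple R[i]) :
  p != 0 -> zeros_with_multiplicity p z ->
  p = lead_coef p *: \prod_(k < n) ('X - (tnth z k)%:P).
Proof.
move=> p0 zp; have [r rE] := closed_field_poly_normal p.
have lp0 : lead_coef p != 0 by rewrite lead_coef_eq0.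
have rz : perm_eq r z.
  apply/allP => x _; apply/eqP; rewrite /= -zp {1}rE -mul_polyC mupMr ?mup_prod_XsubC//.
  by rewrite rootC.
by rewrite {1}rE (perm_big _ rz) big_tuple.
Qed.

Lemma circular_derivative_modulus n (x : R[i]) (z z' : n.-tuple R[i]) (g : n.-tuple R) :
  0 < \sum_(k < n) tnth g k -> zeros_with_multiplicity (circular_poly z g) z' ->
  (forall k, x != tnth z k) ->
  \prod_(k < n) nc (x - tnth z' k) =
  nc (circular_sum x z g) / (\sum_(k < n) tnth g k) * \prod_(k < n) nc (x - tnth z k).
Proof.
move=> g0 zp xz.
have lc := lead_coef_circular_poly _ z _ (lt0r_neq0 g0).
have p0 : circular_poly z g != 0.
  by rewrite -lead_coef_eq0 lc eq_complex/= eqxx andbT gt_eqF.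
have := congr1 (fun p => nc p.[x]) (zeros_with_multiplicity_prod _ _ _ p0 zp).
rewrite /= horner_circular_poly// lc hornerZ horner_prod !ComplexField.Normc.normcM.
rewrite !normc_prod normc_real gtr0_norm// => h.
apply: (mulfI (lt0r_neq0 g0)).
rewrite [RHS]mulrA [_ * (_ / _)]mulrC mulfVK ?gt_eqF// h; congr (_ * _).
by apply: eq_bigr => k _; rewrite hornerXsubC.
Qed.

Lemma circular_weight_lower (x z : R[i]) (M t : R) :
  nc x <= M -> x != z -> t <= nc (x + z) -> 0 < t -> t <= M ->
  t / (4 * M) <= nc (circular_weight x z).
Proof.
rewrite -subr_eq0 -normc_gt0 => xM D0 h2 t0 tM.
rewrite /circular_weight ComplexField.Normc.normcM ComplexField.Normc.normcV.
set D := nc (x - z) in D0 *; set N := nc (x + z) in h2 *.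
have nx : nc (x *+ 2) = 2 * nc x by rewrite normcMn mulr_natl.
have DN : D <= 2 * M + N.
  have -> : D = nc (x *+ 2 - (x + z)) by rewrite /D; congr nc; ring.
  apply: le_trans (ler_normcD _ _ _) _; rewrite normcN nx lerD2r; lra.
rewrite ler_pdivlMr// mulrAC ler_pdivrMr; last lra.
by nra.
Qed.

Lemma circular_weight_upper (x z : R[i]) (M t : R) :
  nc x <= M -> t <= nc (x - z) -> 0 < t -> t <= M ->
  nc (circular_weight x z) <= 4 * M / t.
Proof.
move=> xM h1 t0 tM.
rewrite /circular_weight ComplexField.Normc.normcM ComplexField.Normc.normcV.
set D := nc (x - z) in h1 *.
have nx : nc (x *+ 2) = 2 * nc x by rewrite normcMn mulr_natl.
have ND : nc (x + z) <= D + 2 * M.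
  have -> : nc (x + z) = nc (x *+ 2 - (x - z)) by congr nc; ring.
  apply: le_trans (ler_normcD _ _ _) _; rewrite normcN nx -/D; lra.
by rewrite ler_pdivrMr ?(lt_le_trans t0)// mulrAC ler_pdivlMr//; nra.
Qed.

Lemma affine_lower_bound (u : R) (a b : R[i]) (e : R) : a != 0 ->
  e < `|u + complex.Re (b / a)| -> e * nc a <= nc (u%:C * a + b).
Proof.
move=> a0 h; have na : 0 < nc a by rewrite normc_gt0.
rewrite -ler_pdivlMr// -ComplexField.Normc.normcV -ComplexField.Normc.normcM.
rewrite mulrDl mulfK//; apply: le_trans (ltW h) _.
by apply: le_trans (ler_abs_Re _ _); rewrite raddfD.
Qed.

(** The real number closest to the complex value of the weight [k0] for which
    [circular_sum x z g] vanishes; it does not depend on [tnth g k0]. *)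
Definition critical_value {n} (k0 : 'I_n) (x : R[i]) (z : n.-tuple R[i])
    (g : n.-tuple R) : R :=
  - complex.Re
    ((\sum_(k < n | k != k0) (tnth g k)%:C * circular_weight x (tnth z k)) /
       circular_weight x (tnth z k0)).

Lemma sum_ln n (F : 'I_n -> R) : (forall k, 0 < F k) ->
  \sum_(k < n) ln (F k) = ln (\prod_(k < n) F k).
Proof.
move=> F0.
suff : 0 < \prod_(k < n) F k /\ \sum_(k < n) ln (F k) = ln (\prod_(k < n) F k).
  by case.
elim/big_ind2: _ => [|u v u' v' [v0 ->] [v'0 ->]|//]; first by rewrite ln1.
by rewrite mulr_gt0// lnM ?posrE.
Qed.

Lemma ln_ratio (u K : R) : 0 < u -> 1 <= K -> u <= K -> 1 <= K * u -> `|ln u| <= ln K.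
Proof.
move=> u0 K1 uK Ku; have K0 : 0 < K by lra.
rewrite ler_norml ler_ln ?posrE// uK andbT -lnV ?posrE// ler_ln ?posrE ?invr_gt0//.
by rewrite -[K^-1]mul1r ler_pdivrMr// mulrC.
Qed.

(** The ratio of the two products is [nc (circular_sum x z g)] over the total
    weight. The distance of [tnth g k0] to the critical value keeps the numerator
    away from [0]; [K] bounds the ratio and its inverse. *)
Lemma log_potential_step n (k0 : 'I_n) (x : R[i]) (z z' : n.-tuple R[i]) (g : n.-tuple R)
    (M t r X K : R) :
  zeros_with_multiplicity (circular_poly z g) z' ->
  nc x <= M -> 0 < t -> t <= M -> (forall k, t <= nc (x - tnth z k)) ->
  (forall k, t <= nc (x - tnth z' k)) ->
  t <= nc (x + tnth z k0) ->
  (forall k, 0 < tnth g k) -> (forall k, tnth g k <= X) ->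
  0 < r -> r < `|tnth g k0 - critical_value k0 x z g| ->
  4 * M / t <= K -> 4 * M * n%:R * X <= K * (r * t) ->
  `|log_potential x z' - log_potential x z| <= ln K.
Proof.
move=> zp xM t0 tM xz xz' xz0 g0 gX r0 rg K1 K2.
have M0 : 0 < M by lra.
have n0 : (0 < n)%N by case: n k0 {K2 rg z z' g zp xz xz' xz0 g0 gX} => // -[].
pose G := \sum_(k < n) tnth g k.
have G0 : 0 < G.
  by rewrite /G (bigD1 k0)//= ltr_pwDl// sumr_ge0// => k _; exact: ltW.
have GX : G <= n%:R * X.
  rewrite mulr_natl -[n in X *+ n]card_ord -sumr_const; exact: ler_sum.
have neq y : t <= nc (x - y) -> x != y.
  by rewrite -subr_eq0 -normc_gt0; exact: lt_le_trans.
have a1 := circular_weight_lower _ _ _ _ xM (neq _ (xz k0)) xz0 t0 tM.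
have a00 : 0 < t / (4 * M) by rewrite divr_gt0 ?mulr_gt0.
have Slow : r * (t / (4 * M)) <= nc (circular_sum x z g).
  rewrite /circular_sum (bigD1 k0)//=.
  apply: le_trans (affine_lower_bound _ _ _ r _ _).
  - by rewrite ler_wpM2l// ltW.
  - by rewrite -normc_gt0 (lt_le_trans a00).
  - by move: rg; rewrite /critical_value opprK.
have weight_up k : nc (circular_weight x (tnth z k)) <= 4 * M / t.
  exact: circular_weight_upper xM (xz k) t0 tM.
have Sup : nc (circular_sum x z g) <= 4 * M / t * G.
  apply: le_trans (ler_normc_sum _ _ _ _ _) _; rewrite mulr_sumr ler_sum// => k _.
  by rewrite ComplexField.Normc.normcM normc_real gtr0_norm// mulrC ler_wpM2r// ltW.
have S0 : 0 < nc (circular_sum x z g) by rewrite (lt_le_trans _ Slow)// mulr_gt0.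
have p0 y : (forall k, t <= nc (x - tnth y k)) -> 0 < \prod_(k < n) nc (x - tnth y k).
  by move=> h; rewrite prodr_gt0// => k _; exact: lt_le_trans (h k).
have lnE y : (forall k, t <= nc (x - tnth y k)) ->
    log_potential x y = ln (\prod_(k < n) nc (x - tnth y k)).
  by move=> h; apply: sum_ln => k; exact: lt_le_trans (h k).
have SG0 : 0 < nc (circular_sum x z g) / G by rewrite divr_gt0.
rewrite !lnE// (circular_derivative_modulus _ _ _ _ _ G0 zp) -/G; last by move=> k; exact: neq.
rewrite lnM ?posrE ?p0// addrK.
have K3 : 1 <= 4 * M / t by rewrite ler_pdivlMr//; lra.
apply: ln_ratio => //.
- by apply: le_trans K1.
- by apply: le_trans K1; rewrite ler_pdivrMr.
- rewrite mulrA ler_pdivlMr// mul1r.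
  have K0 : 0 < K by lra.
  have : K * (r * (t / (4 * M))) <= K * nc (circular_sum x z g) by rewrite ler_pM2l.
  apply: le_trans; apply: le_trans GX _.
  by rewrite !mulrA ler_pdivlMr ?mulr_gt0// mulrC !mulrA; rewrite !mulrA in K2.
Qed.

End circular_step.

Section measurable_complex_arithmetic.
Context d (S : measurableType d) (R : realType).
Implicit Types f h : S -> R[i].

(** Complex arithmetic reduces to real arithmetic on the two parts. *)
Definition parts_measurable f :=
  measurable_fun setT (fun w => complex.Re (f w)) /\
  measurable_fun setT (fun w => complex.Im (f w)).

Lemma parts_measurable_borel (f : S -> borelC R) :
  measurable_fun setT f -> parts_measurable f.
Proof.
move=> mf; split.
- exact: (measurableT_comp (@measurable_Re R) mf).
- exact: (measurableT_comp (@measurable_Im R) mf).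
Qed.

Lemma parts_measurable_cst z : parts_measurable (fun=> z).
Proof. by split; exact: measurable_cst. Qed.

Lemma parts_measurableD f h : parts_measurable f -> parts_measurable h ->
  parts_measurable (fun w => f w + h w).
Proof.
move=> [f1 f2] [h1 h2]; split.
- rewrite (_ : (fun w => _) = (fun w => complex.Re (f w)) \+ (fun w => complex.Re (h w))).
    exact: measurable_funD.
  by apply/funext => w /=; rewrite raddfD.
- rewrite (_ : (fun w => _) = (fun w => complex.Im (f w)) \+ (fun w => complex.Im (h w))).
    exact: measurable_funD.
  by apply/funext => w /=; rewrite raddfD.
Qed.

Lemma parts_measurableN f : parts_measurable f -> parts_measurable (fun w => - f w).
Proof.
move=> [f1 f2]; split.
- rewrite (_ : (fun w => _) = (\- (fun w => complex.Re (f w)))).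
    exact: measurable_funN.
  by apply/funext => w /=; rewrite raddfN.
- rewrite (_ : (fun w => _) = (\- (fun w => complex.Im (f w)))).
    exact: measurable_funN.
  by apply/funext => w /=; rewrite raddfN.
Qed.

Lemma parts_measurableM f h : parts_measurable f -> parts_measurable h ->
  parts_measurable (fun w => f w * h w).
Proof.
move=> [f1 f2] [h1 h2]; split.
- rewrite (_ : (fun w => _) = ((fun w => complex.Re (f w)) \* (fun w => complex.Re (h w)))
      \- ((fun w => complex.Im (f w)) \* (fun w => complex.Im (h w)))).
    by apply: measurable_funB; exact: measurable_funM.
  by apply/funext => w /=; case: (f w) => ? ?; case: (h w).
- rewrite (_ : (fun w => _) = ((fun w => complex.Re (f w)) \* (fun w => complex.Im (h w)))
      \+ ((fun w => complex.Im (f w)) \* (fun w => complex.Re (h w)))).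
    by apply: measurable_funD; exact: measurable_funM.
  by apply/funext => w /=; case: (f w) => ? ?; case: (h w).
Qed.

Lemma parts_measurableV f : parts_measurable f -> parts_measurable (fun w => (f w)^-1).
Proof.
move=> [f1 f2].
pose q w := complex.Re (f w) ^+ 2 + complex.Im (f w) ^+ 2.
have mq : measurable_fun setT (fun w => (q w)^-1).
  rewrite (_ : (fun w => _) = (fun w => q w `^ (-1))).
    apply: (measurableT_comp (@measurable_powR R (-1))).
    by apply: measurable_funD; exact: measurable_funX.
  by apply/funext => w; rewrite powR_inv1// /q addr_ge0// sqr_ge0.
split.
- have -> : (fun w => complex.Re ((f w)^-1)) = (fun w => complex.Re (f w)) \* (fun w => (q w)^-1).
    by apply/funext => w /=; rewrite /q; case: (f w).
  exact: measurable_funM.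
- have -> : (fun w => complex.Im ((f w)^-1)) = \- ((fun w => complex.Im (f w)) \* (fun w => (q w)^-1)).
    by apply/funext => w /=; rewrite /q; case: (f w) => ? ? /=; rewrite ?mulNr.
  by apply: measurable_funN; exact: measurable_funM.
Qed.

Lemma parts_measurable_real (h : S -> R) : measurable_fun setT h ->
  parts_measurable (fun w => (h w)%:C%C).
Proof. by move=> mh; split => //=; exact: measurable_cst. Qed.

Lemma parts_measurable_sum (I : Type) (r : seq I) (p : pred I) (F : I -> S -> R[i]) :
  (forall i, p i -> parts_measurable (F i)) ->
  parts_measurable (fun w => \sum_(i <- r | p i) F i w).
Proof.
move=> mF; elim: r => [|i r IH].
  rewrite (_ : (fun w => _) = fun=> 0); first exact: parts_measurable_cst.
  by apply/funext => w; rewrite big_nil.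
case pi : (p i).
  under eq_fun do rewrite big_cons pi.
  by apply: parts_measurableD => //; exact: mF.
by under eq_fun do rewrite big_cons pi.
Qed.

Lemma measurable_critical_value n (k0 : 'I_n) (x : R[i])
    (z : S -> n.-tuple (borelC R)) (g : S -> n.-tuple R) :
  measurable_fun setT z ->
  (forall k, k != k0 -> measurable_fun setT (fun w => tnth (g w) k)) ->
  measurable_fun setT (fun w => critical_value R k0 x (z w) (g w)).
Proof.
move=> mz mg.
have mw k : parts_measurable (fun w => circular_weight R x (tnth (z w) k)).
  have mzk : parts_measurable (fun w => tnth (z w) k).
    apply: parts_measurable_borel.
    by move/measurable_fun_tnthP : mz; exact.
  apply: parts_measurableM; [|apply: parts_measurableV]; apply: parts_measurableD => //;
    by [exact: parts_measurable_cst|exact: parts_measurableN].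
apply: measurable_funN.
suff : parts_measurable (fun w => (\sum_(k < n | k != k0)
    (tnth (g w) k)%:C%C * circular_weight R x (tnth (z w) k)) /
    circular_weight R x (tnth (z w) k0)) by case.
apply: parts_measurableM; last exact: parts_measurableV.
apply: parts_measurable_sum => k kk0; apply: parts_measurableM => //.
exact: parts_measurable_real (mg k kk0).
Qed.

End measurable_complex_arithmetic.

(** * Averages of the logarithmic potential on a circle *)

Section circle_average.
Context (R : realType).
Local Open Scope complex_scope.

(** The logarithmic potential of the uniform measure on the circle of radius [r]
    around [0]. *)
Definition truncated_log (r : R) (w : R[i]) : R := ln (Num.max r (nc w)).

(** The points are the zeros of [('X - c) ^+ n - r ^+ n]. *)
Lemma circle_points (c : R[i]) (r : R) n : 0 <= r -> (0 < n)%N ->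
  exists s : n.-tuple R[i], (forall i, nc (tnth s i - c) = r) /\
    forall w, \prod_(i < n) (w - tnth s i) = (w - c) ^+ n - (r ^+ n)%:C.
Proof.
move=> r0 n0.
pose p : {poly R[i]} := ('X - c%:P) ^+ n - ((r ^+ n)%:C)%:P.
have szX : size (('X - c%:P) ^+ n) = n.+1.
  by rewrite -[n]card_ord -prodr_const size_prod_XsubC /index_enum -enumT size_enum_ord card_ord.
have sz : (size (- ((r ^+ n)%:C)%:P : {poly R[i]}) < size (('X - c%:P) ^+ n))%N.
  by rewrite szX size_polyN (leq_ltn_trans (size_polyC_leq1 _)).
have [s pE] := closed_field_poly_normal p.
have lp : lead_coef p = 1.
  by rewrite /p lead_coefDl// (monicP (monic_exp _ (monicXsubC _))).
rewrite lp scale1r in pE.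
have szs : size s == n.
  by rewrite -eqSS -(size_prod_XsubC s id) -pE /p size_polyDl// szX.
have hp w : p.[w] = (w - c) ^+ n - (r ^+ n)%:C.
  by rewrite /p hornerD hornerN hornerC horner_exp hornerXsubC.
exists (Tuple szs); split => [i|w]; last first.
  rewrite -hp pE horner_prod (big_tuple _ _ (Tuple szs) xpredT (fun y => ('X - y%:P).[w])).
  by apply: eq_bigr => i _; rewrite hornerXsubC.
have : root p (tnth (Tuple szs) i).
  by rewrite pE root_prod_XsubC mem_tnth.
rewrite /root hp subr_eq0 => /eqP /(congr1 (@ComplexField.Normc.normc R)).
rewrite normcX normc_real ger0_norm ?exprn_ge0// => /eqP.
by rewrite eqrXn2 ?normc_ge0// => /eqP.
Qed.

(** The larger of the two powers dominates; by the separation [t], the quotient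
    of the bases is at most [r / (r + t)]. *)
Lemma truncated_log_power_bounds (v : R[i]) (r t : R) n :
  0 < t -> t <= r -> t <= `|nc v - r| -> (0 < n)%N ->
  t / (r + t) * Num.max r (nc v) ^+ n <= nc (v ^+ n - (r ^+ n)%:C) /\
  nc (v ^+ n - (r ^+ n)%:C) <= 2 * Num.max r (nc v) ^+ n.
Proof.
move=> t0 tr tv n0; have r0 : 0 < r by lra.
have v0 := normc_ge0 R v; set V := nc v in tv v0 *.
have rn : nc (r ^+ n)%:C = r ^+ n by rewrite normc_real ger0_norm// exprn_ge0// ltW.
split; last first.
  apply: le_trans (ler_normcD _ _ _) _; rewrite normcN rn normcX -/V mulr2n mulrDl mul1r.
  by apply: lerD; rewrite lerXn2r ?nnegrE ?le_max ?lexx ?orbT// ltW.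
have gen (M m : R) : 0 <= m -> m + t <= M -> t * M <= (M - m) * (r + t) ->
    t / (r + t) * M ^+ n <= M ^+ n - m ^+ n.
  move=> m0 mM h; case: n n0 {rn} => // n _.
  have mMn : m ^+ n <= M ^+ n by rewrite lerXn2r ?nnegrE//; lra.
  have Mn0 : 0 <= M ^+ n by rewrite exprn_ge0//; lra.
  rewrite mulrAC ler_pdivrMr; last lra.
  rewrite !exprS.
  have : m * m ^+ n <= m * M ^+ n by rewrite ler_wpM2l.
  have : t * M * M ^+ n <= (M - m) * (r + t) * M ^+ n by rewrite ler_wpM2r.
  by nra.
have [Vr|rV] := leP V r.
  rewrite -normcN opprB; apply: le_trans (ler_normcB _ _ _); rewrite rn normcX -/V.
  rewrite ler0_norm in tv; last lra.
  apply: gen => //; [lra|nra].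
apply: le_trans (ler_normcB _ _ _); rewrite rn normcX -/V.
rewrite gtr0_norm in tv; last lra.
by apply: gen => //; [lra|lra|nra].
Qed.

Definition circle_error (r t : R) : R := ln ((r + t) / t).

(** By the factorization of [w ^+ n - r ^+ n], the average of [ln |s - w|] over
    [n] equidistributed points of the circle is explicit; the error in Jensen's
    formula for the [n] points is of order [1 / n]. *)
Lemma circle_log_average (c : R[i]) (r t : R) n (s : n.-tuple R[i]) (w : R[i]) :
  (forall w, \prod_(i < n) (w - tnth s i) = (w - c) ^+ n - (r ^+ n)%:C) ->
  (forall i, nc (tnth s i - c) = r) -> (0 < n)%N ->
  0 < t -> t <= r -> t <= `|nc (w - c) - r| ->
  `|\sum_(i < n) ln (nc (tnth s i - w)) - n%:R * truncated_log r (w - c)|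
     <= circle_error r t.
Proof.
move=> hs sc n0 t0 tr tw; have r0 : 0 < r by lra.
have sw i : 0 < nc (tnth s i - w).
  apply: lt_le_trans t0 (le_trans tw _).
  rewrite -(sc i); apply: le_trans (ler_dist_normc _ _ _) _.
  by rewrite normcB (_ : _ - _ = tnth s i - w)//; ring.
have -> : \sum_(i < n) ln (nc (tnth s i - w)) = ln (nc ((w - c) ^+ n - (r ^+ n)%:C)).
  rewrite -hs normc_prod (eq_bigr (fun i => ln (nc (w - tnth s i)))).
    by apply: sum_ln => i; rewrite normcB.
  by move=> i _; rewrite normcB.
have [lo up] := truncated_log_power_bounds (w - c) r t n t0 tr tw n0.
set N := nc (_ - _%:C) in lo up *; rewrite /truncated_log; set M := Num.max _ _ in lo up *.
have M0 : 0 < M by rewrite /M lt_max r0.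
have Mn : 0 < M ^+ n by rewrite exprn_gt0.
have q0 : 0 < t / (r + t) by rewrite divr_gt0//; lra.
have N0 : 0 < N by apply: lt_le_trans _ lo; rewrite mulr_gt0.
have -> : n%:R * ln M = ln (M ^+ n) by rewrite lnXn// mulr_natl.
rewrite -ln_div ?posrE//; apply: ln_ratio; first by rewrite divr_gt0.
- by rewrite ler_pdivlMr//; lra.
- rewrite ler_pdivrMr//; apply: le_trans up _; rewrite ler_wpM2r//; first exact: ltW.
  by rewrite ler_pdivlMr//; lra.
- rewrite mulrA ler_pdivlMr// mul1r.
  rewrite -ler_pdivrMl ?divr_gt0//; last lra.
  by apply: le_trans lo; rewrite invf_div.
Qed.

Lemma truncated_log_lipschitz_radius (r r' : R) w : 0 < r -> r <= r' ->
  `|truncated_log r' w - truncated_log r w| <= (r' - r) / r.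
Proof.
move=> r0 rr'; rewrite /truncated_log.
have M0 : 0 < Num.max r (nc w) by rewrite lt_max r0.
have MM : Num.max r (nc w) <= Num.max r' (nc w).
  by rewrite ge_max !le_max rr' lexx !orbT.
have M0' := lt_le_trans M0 MM.
rewrite ger0_norm ?subr_ge0 ?ler_ln ?posrE// -ln_div ?posrE//.
set A := Num.max r' _ in MM M0' *; set B := Num.max r _ in MM M0 *.
have AB : A <= B + (r' - r).
  rewrite /A ge_max /B; apply/andP; split.
    by have : r <= Num.max r (nc w) by [rewrite le_max lexx]; lra.
  by rewrite ler_wpDr ?subr_ge0// le_max lexx orbT.
have rB : r <= B by rewrite /B le_max lexx.
apply: (@le_trans _ _ (A / B - 1)).
  have AB0 : 0 < A / B by rewrite divr_gt0.
  by rewrite -{1}(subrKC 1 (A / B)) le_ln1Dx//; lra.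
rewrite (_ : A / B - 1 = (A - B) / B); last by field; rewrite gt_eqF.
apply: (@le_trans _ _ ((r' - r) / B)).
  by rewrite ler_wpM2r ?invr_ge0 ?(ltW M0)//; lra.
by rewrite ler_wpM2l ?subr_ge0// lef_pV2 ?posrE.
Qed.

(** Each value spoils at most one of the candidate radii [r0 + 2 t i]. *)
Lemma pigeonhole_radius (vals : seq R) (r0 t : R) N : 0 < t -> (size vals < N)%N ->
  exists2 i : 'I_N, true & forall v, v \in vals -> t <= `|v - (r0 + 2 * t * i%:R)|.
Proof.
move=> t0 sN; apply: contrapT => H.
have /choice[f Hf] : forall i : 'I_N, exists v, v \in vals /\ `|v - (r0 + 2 * t * i%:R)| < t.
  move=> i; apply: contrapT => Hi; apply: H; exists i => // v vv.
  by rewrite leNgt; apply/negP => h; apply: Hi; exists v.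
have finj : injective f.
  move=> i j fij; have [_ hi] := Hf i; have [_ hj] := Hf j.
  rewrite fij in hi; apply/val_inj/eqP => /=; rewrite -(eqr_nat R).
  move: hi hj; rewrite !ltr_norml => /andP[a1 a2] /andP[b1 b2].
  have [ij|ji|->//] := ltgtP i j; exfalso.
    have : (i.+1%:R : R) <= j%:R by rewrite ler_nat.
    by rewrite -natr1; nra.
  have : (j.+1%:R : R) <= i%:R by rewrite ler_nat.
  by rewrite -natr1; nra.
have : (size (map f (enum 'I_N)) <= size vals)%N.
  apply: uniq_leq_size; first by rewrite map_inj_uniq// enum_uniq.
  by move=> _ /mapP[i _ ->]; case: (Hf i).
by rewrite size_map size_enum_ord leqNgt sN.
Qed.

Definition average {n} (z : n.-tuple R[i]) (f : R[i] -> R) : R :=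
  n%:R^-1 * \sum_(k < n) f (tnth z k).

(** Exchanging the sums over the circle and over the zeros turns pointwise
    bounds on the potentials into a bound for [truncated_log]. *)
Lemma average_truncated_log_step n (z z' : n.-tuple R[i]) (s : n.-tuple R[i])
    (c : R[i]) (r t L : R) :
  (forall w, \prod_(i < n) (w - tnth s i) = (w - c) ^+ n - (r ^+ n)%:C) ->
  (forall i, nc (tnth s i - c) = r) -> (0 < n)%N -> 0 < t -> t <= r ->
  (forall k, t <= `|nc (tnth z k - c) - r|) ->
  (forall k, t <= `|nc (tnth z' k - c) - r|) ->
  (forall i, `|log_potential R (tnth s i) z' - log_potential R (tnth s i) z| <= L) ->
  `|average z' (fun w => truncated_log r (w - c)) -
    average z (fun w => truncated_log r (w - c))| <=
  L / n%:R + 2 * circle_error r t / n%:R.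
Proof.
move=> hs sc n0 t0 tr hz hz' hL.
have nR : 0 < n%:R :> R by rewrite ltr0n.
have key (y : n.-tuple R[i]) : (forall k, t <= `|nc (tnth y k - c) - r|) ->
    `|\sum_(i < n) log_potential R (tnth s i) y -
      n%:R * \sum_(k < n) truncated_log r (tnth y k - c)| <= n%:R * circle_error r t.
  move=> hy; rewrite /log_potential exchange_big/= mulr_sumr -sumrB.
  apply: le_trans (ler_norm_sum _ _ _) _.
  rewrite [X in _ <= X]mulr_natl -[n in X in _ <= X]card_ord -sumr_const.
  by apply: ler_sum => k _; exact: circle_log_average.
have hd : `|\sum_(i < n) log_potential R (tnth s i) z' -
    \sum_(i < n) log_potential R (tnth s i) z| <= n%:R * L.
  rewrite -sumrB; apply: le_trans (ler_norm_sum _ _ _) _.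
  rewrite [X in _ <= X]mulr_natl -[n in X in _ <= X]card_ord -sumr_const.
  exact: ler_sum.
have := key z hz; have := key z' hz'.
move: hd; rewrite /average.
set A := \sum_(i < n) log_potential _ _ z'; set B := \sum_(i < n) log_potential _ _ z.
set A' := \sum_(k < n) truncated_log _ _; set B' := \sum_(k < n) truncated_log _ _.
set E := circle_error _ _ => hd h' h.
rewrite -mulrBr normrM gtr0_norm ?invr_gt0// mulrC -mulrDl ler_pM2r ?invr_gt0//.
rewrite -(ler_pM2l nR) -{1}(gtr0_norm nR) -normrM.
move: hd h' h; rewrite !ler_norml => /andP[h1 h2] /andP[h3 h4] /andP[h5 h6].
by clear -h1 h2 h3 h4 h5 h6; apply/andP; split; nra.
Qed.

End circle_average.

(** * Logarithmic tents and weak convergence *)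

Section tents.
Context (R : realType).
Local Open Scope complex_scope.
Implicit Types (v w c : R[i]).

Lemma truncated_log_lipschitz (r : R) v w : 0 < r ->
  `|truncated_log R r v - truncated_log R r w| <= nc (v - w) / r.
Proof.
move=> r0.
suff gen (x y : R[i]) : truncated_log R r x - truncated_log R r y <= nc (x - y) / r.
  by rewrite ler_norml gen andbT lerNl opprB normcB gen.
rewrite /truncated_log; set A := Num.max _ (nc x); set B := Num.max _ (nc y).
have rA : r <= A by rewrite /A le_max lexx.
have rB : r <= B by rewrite /B le_max lexx.
have xy := ler_normcB R x y; have xy0 := normc_ge0 R (x - y).
have AB : A <= B + nc (x - y).
  rewrite /A ge_max; apply/andP; split; first lra.
  have : nc y <= B by rewrite /B le_max lexx orbT.
  by lra.
have A0 : 0 < A by lra. have B0 : 0 < B by lra.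
rewrite -ln_div ?posrE//.
have AB0 : 0 < A / B by rewrite divr_gt0.
apply: (@le_trans _ _ (A / B - 1)).
  by rewrite -{1}(subrKC 1 (A / B)) le_ln1Dx//; lra.
rewrite (_ : A / B - 1 = (A - B) / B); last by field; rewrite gt_eqF.
apply: (@le_trans _ _ (nc (x - y) / B)).
  by rewrite ler_wpM2r ?invr_ge0 ?(ltW B0)//; lra.
by rewrite ler_wpM2l// lef_pV2 ?posrE.
Qed.

Definition tent v : R := truncated_log R 2 v - truncated_log R 1 v.

Lemma tent_ge0 v : 0 <= tent v.
Proof.
rewrite subr_ge0 ler_ln ?posrE ?lt_max ?ltr01 ?ltr0n//.
by rewrite ge_max !le_max lexx orbT andbT; apply/orP; left; lra.
Qed.

Lemma tent_eq0 v : 2 <= nc v -> tent v = 0.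
Proof.
by move=> v2; rewrite /tent /truncated_log !max_r ?subrr//; lra.
Qed.

Lemma tent_plateau v : nc v <= 1 -> tent v = ln 2.
Proof.
by move=> v1; rewrite /tent /truncated_log !max_l ?ln1 ?subr0//; lra.
Qed.

Lemma tent_lipschitz v w : `|tent v - tent w| <= 2 * nc (v - w).
Proof.
have h2 := @truncated_log_lipschitz 2 v w (ltr0n _ 2).
have h1 := @truncated_log_lipschitz 1 v w ltr01.
rewrite /tent; move: h1 h2; rewrite divr1 !ler_norml => /andP[? ?] /andP[? ?].
by have := normc_ge0 R (v - w); move=> ?; apply/andP; split; lra.
Qed.

Lemma tent_scale (k : R) v : 0 < k ->
  tent (k%:C * v) = truncated_log R (2 / k) v - truncated_log R k^-1 v.
Proof.
move=> k0.
suff gen (r : R) : 0 < r -> truncated_log R r (k%:C * v) = ln k + truncated_log R (r / k) v.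
  by rewrite /tent !gen// div1r; ring.
move=> r0; rewrite /truncated_log ComplexField.Normc.normcM normc_real gtr0_norm//.
rewrite -lnM ?posrE//; last by rewrite lt_max divr_gt0.
by rewrite maxr_pMr ?ltW// mulrCA divff ?mulr1// gt_eqF.
Qed.

(** The sums below run over finite squares of Gaussian integers, given as
    duplicate-free sequences of pairs of integers. *)
Definition box (a b : int) (L : nat) : seq (int * int) :=
  [seq (a + i%:Z, b + j%:Z) | i <- iota 0 L, j <- iota 0 L].

Lemma mem_box a b L x : (x \in box a b L) =
  [&& a <= x.1, x.1 < a + L%:Z, b <= x.2 & x.2 < b + L%:Z].
Proof.
case: x => x y; apply/allpairsP/idP => [[[i j] /= [+ + [-> ->]]]|].
  by rewrite !mem_iota; lia.
move=> /and4P[/= h1 h2 h3 h4]; exists (`|x - a|%N, `|y - b|%N); rewrite !mem_iota /=.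
split; [lia|lia|]; congr (_, _); lia.
Qed.

Lemma uniq_box a b L : uniq (box a b L).
Proof.
apply: allpairs_uniq; rewrite ?iota_uniq// => -[i j] [i' j'] _ _ /= [h1 h2].
by congr (_, _); lia.
Qed.

Lemma size_box a b L : size (box a b L) = (L * L)%N.
Proof. by rewrite size_allpairs !size_iota. Qed.

Lemma sum_shift_box (F : int * int -> R) a b a' b' L :
  \sum_(x <- box (a + a') (b + b') L) F x =
  \sum_(x <- box a b L) F (x.1 + a', x.2 + b').
Proof.
rewrite /box !big_allpairs_dep; apply: eq_bigr => i _; apply: eq_bigr => j _ /=.
by congr (F (_, _)); ring.
Qed.

Lemma ler_sum_support (I : eqType) (F : I -> R) (s1 s2 : seq I) :
  uniq s1 -> uniq s2 -> (forall x, 0 <= F x) -> (forall x, F x != 0 -> x \in s1 -> x \in s2) ->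
  \sum_(x <- s1) F x <= \sum_(x <- s2) F x.
Proof.
move=> u1 u2 F0 Fs.
have -> : \sum_(x <- s1) F x = \sum_(x <- [seq x <- s1 | x \in s2]) F x.
  rewrite big_filter [RHS]big_mkcond/=; apply: eq_big_seq => x xs1.
  by case: ifPn => // xs2; apply/eqP/negPn/negP => /Fs /(_ xs1); rewrite (negbTE xs2).
have pe : perm_eq [seq x <- s1 | x \in s2] [seq x <- s2 | x \in s1].
  by apply: uniq_perm; rewrite ?filter_uniq// => x; rewrite !mem_filter andbC.
rewrite (perm_big _ pe) big_filter big_mkcond/=; apply: ler_sum => x _; by case: ifP.
Qed.

Definition gauss (x : int * int) : R[i] := x.1%:~R +i* x.2%:~R.

(** Seen from the lattice of Gaussian integers, the tent around [x] has height
    [ln 2] and support of radius [4 * p]. *)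
Definition bump (p : nat) (u : R[i]) (x : int * int) : R :=
  tent ((2 * p%:R)^-1%:C * (u - gauss x)).

Definition half_window (p : nat) : nat := (4 * p + 1)%N.

(** A square of lattice points around the cell of [(a, b)], large enough to
    contain all [x] for which [bump p u x] is nonzero, for [u] in that cell. *)
Definition window (p : nat) (a b : int) : seq (int * int) :=
  box (- (half_window p)%:Z + a) (- (half_window p)%:Z + b) (half_window p).*2.+1.

Definition window_mass (p : nat) : R := \sum_(x <- window p 0 0) bump p 0 x.

Lemma bump_ge0 p u x : 0 <= bump p u x.
Proof. exact: tent_ge0. Qed.

Lemma normc_scale (k : R) v : 0 <= k -> nc (k%:C * v) = k * nc v.
Proof. by move=> k0; rewrite ComplexField.Normc.normcM normc_real ger0_norm. Qed.

Lemma ler_normc_parts v : nc v <= `|complex.Re v| + `|complex.Im v|.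
Proof.
case: v => a b /=; rewrite -[leRHS]ger0_norm ?addr_ge0// -sqrtr_sqr.
rewrite ler_wsqrtr// sqrrD !real_normK ?num_real//.
by have : 0 <= `|a| * `|b| by [rewrite mulr_ge0]; lra.
Qed.

Lemma bump_support p u x : (0 < p)%N -> bump p u x != 0 ->
  nc (u - gauss x) < 4 * p%:R.
Proof.
move=> p0; apply: contraNT; rewrite -leNgt => h.
have P0 : 0 < p%:R :> R by rewrite ltr0n.
have k0 : 0 < 2 * p%:R :> R by lra.
apply/eqP/tent_eq0; rewrite normc_scale ?invr_ge0 ?(ltW k0)// mulrC ler_pdivlMr//.
by lra.
Qed.

Lemma sum_window_shift p u a b :
  \sum_(x <- window p a b) bump p u x = \sum_(x <- window p 0 0) bump p (u - gauss (a, b)) x.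
Proof.
rewrite {1}/window sum_shift_box /window !addr0; apply: eq_bigr => x _.
rewrite /bump; congr (tent (_ * _)).
rewrite -addrA -opprD; congr (_ - _).
by apply/eqP; rewrite eq_complex /= !intrD !(addrC x.1%:~R) !(addrC x.2%:~R) !eqxx.
Qed.

(** By periodicity [u] may be moved to the unit cell at [0]. This changes each of
    the [O (p ^ 2)] terms by [O (1 / p)], since [bump p] is Lipschitz with that
    constant, while the total mass is of order [p ^ 2]. *)
Lemma sum_window_near_mass p u : (0 < p)%N ->
  `|\sum_(x <- window p (Num.floor (complex.Re u)) (Num.floor (complex.Im u))) bump p u x
     - window_mass p| <= 242 * p%:R.
Proof.
move=> p0; rewrite sum_window_shift -sumrB.
have P0 : 1 <= p%:R :> R by rewrite (ler_nat R 1).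
set g := gauss _.
have ug : nc (u - g) <= 2.
  apply: le_trans (ler_normc_parts _) _; rewrite !raddfB /=.
  have /andP[h1 h2] := floor_itv (complex.Re u); have /andP[h3 h4] := floor_itv (complex.Im u).
  rewrite intrD in h2; rewrite intrD in h4.
  by rewrite !ger0_norm ?subr_ge0//; lra.
apply: le_trans (ler_norm_sum _ _ _) _.
apply: (@le_trans _ _ (\sum_(x <- window p 0 0) (2 / p%:R))).
  apply: ler_sum => x _; apply: le_trans (tent_lipschitz _ _) _.
  rewrite -mulrBr normc_scale ?invr_ge0//.
  rewrite (_ : _ - _ = u - g); last by ring.
  rewrite invfM mulrA mulrA divff ?mul1r; last by lra.
  by rewrite mulrC ler_wpM2r// invr_ge0; lra.
rewrite big_const_seq count_predT size_box iter_addr_0 -[leLHS]mulr_natl.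
rewrite mulrA ler_pdivrMr; last lra.
(* [242] comes from [(8 * p + 3) ^ 2 <= 121 * p ^ 2] terms of size [2 / p]. *)
have -> : (half_window p).*2.+1 = (8 * p + 3)%N by rewrite /half_window; lia.
by rewrite natrM natrD natrM; nra.
Qed.

Lemma window_mass_ge p : (0 < p)%N -> p%:R ^+ 2 * ln 2 <= window_mass p.
Proof.
move=> p0.
have P0 : 1 <= p%:R :> R by rewrite (ler_nat R 1).
apply: (@le_trans _ _ (\sum_(x <- box 0 0 p) bump p 0 x)); last first.
  apply: ler_sum_support; rewrite ?uniq_box// => x; first exact: bump_ge0.
  by move=> _; rewrite /window !mem_box /half_window; lia.
rewrite (eq_big_seq (fun=> ln 2)).
  by rewrite big_const_seq count_predT size_box iter_addr_0 -[leRHS]mulr_natl natrM expr2.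
move=> x; rewrite mem_box => /and4P[h1 h2 h3 h4]; apply: tent_plateau.
rewrite normc_scale ?invr_ge0//.
rewrite mulrC ler_pdivrMr; last lra.
rewrite sub0r normcN mul1r; apply: le_trans (ler_normc_parts _) _.
rewrite /gauss/= !ger0_norm ?ler0z//.
have : x.1%:~R <= p%:~R :> R by rewrite ler_int; lia.
have : x.2%:~R <= p%:~R :> R by rewrite ler_int; lia.
by rewrite -pmulrn; lra.
Qed.

Section approximation_from_below.
Variable f : R[i] -> R.
Hypothesis f0 : forall v, 0 <= f v.
Hypothesis cf : continuous (f : R[i]^o -> R).

(** In the original scale the lattice has mesh [1 / (4 * p ^ 2)] and the tents
    have radius [1 / p]. *)
Definition node (p : nat) (x : int * int) : R[i] := (4 * p%:R ^+ 2)^-1%:C * gauss x.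

Definition local_inf (p : nat) (x : int * int) : R :=
  inf [set f v | v in [set v | nc (v - node p x) <= p%:R^-1]].

(** The denominator is an upper bound for the sum of all tents at any point, so
    that [tent_sum] stays below [f]; the square of half side [16 * p ^ 3] in
    the lattice covers the disc of radius [p]. *)
Definition tent_sum (p : nat) (w : R[i]) : R :=
  (window_mass p + 242 * p%:R)^-1 *
  \sum_(x <- box (- (16 * p ^ 3)%:Z) (- (16 * p ^ 3)%:Z) (32 * p ^ 3).+1)
    local_inf p x * bump p ((4 * p%:R ^+ 2)%:C * w) x.

Lemma local_inf_le p x v : nc (v - node p x) <= p%:R^-1 -> local_inf p x <= f v.
Proof.
by move=> h; apply: ge_inf; [exists 0 => _ [u _ <-]|exists v].
Qed.

Lemma local_inf_ge p x (m : R) :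
  (forall v, nc (v - node p x) <= p%:R^-1 -> m <= f v) -> m <= local_inf p x.
Proof.
move=> h; apply: lb_le_inf; last by move=> _ [u uc <-]; exact: h.
exists (f (node p x)), (node p x) => //.
by rewrite /mkset subrr ComplexField.Normc.normc0 invr_ge0.
Qed.

Lemma local_inf_ge0 p x : 0 <= local_inf p x.
Proof. exact: local_inf_ge. Qed.

Lemma bump_node p w x : (0 < p)%N ->
  bump p ((4 * p%:R ^+ 2)%:C * w) x = tent ((2 * p%:R)%:C * (w - node p x)).
Proof.
move=> p0; have P0 : p%:R != 0 :> R by rewrite pnatr_eq0 -lt0n.
rewrite /bump; congr tent; rewrite !mulrBr /node !mulrA -!rmorphM /=.
by congr (_%:C * _ - _%:C * _); field.
Qed.

Lemma bump_node_support p w x : (0 < p)%N ->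
  bump p ((4 * p%:R ^+ 2)%:C * w) x != 0 -> nc (w - node p x) <= p%:R^-1.
Proof.
move=> p0; have P0 : 0 < p%:R :> R by rewrite ltr0n.
rewrite bump_node//; apply: contraNT; rewrite -ltNge => h.
apply/eqP/tent_eq0; rewrite normc_scale ?mulr_ge0//.
move: h; rewrite -div1r ltr_pdivrMr// => h; nra.
Qed.

Lemma ln2_ge : 2^-1 <= ln 2 :> R.
Proof.
rewrite -[leRHS]opprK -lnV ?posrE// lerNr -{1}(subrKC 1 2^-1).
by apply: le_trans (le_ln1Dx _) _; lra.
Qed.

Lemma window_mass_large p : (0 < p)%N -> p%:R ^+ 2 / 2 <= window_mass p.
Proof.
move=> p0; apply: le_trans (window_mass_ge p p0).
by rewrite ler_wpM2l ?sqr_ge0 ?ln2_ge.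
Qed.

Lemma denominator_gt0 p : (0 < p)%N -> 0 < window_mass p + 242 * p%:R.
Proof.
move=> p0; have P0 : 0 < p%:R :> R by rewrite ltr0n.
have := window_mass_large p p0; have := sqr_ge0 (p%:R : R); lra.
Qed.

Lemma window_support p u x : (0 < p)%N -> bump p u x != 0 ->
  x \in window p (Num.floor (complex.Re u)) (Num.floor (complex.Im u)).
Proof.
move=> p0 /(bump_support p u x p0) h.
have hr := le_lt_trans (ler_abs_Re _ _) h; have hi := le_lt_trans (ler_abs_Im _ _) h.
move: hr hi; rewrite !raddfB /= !ltr_norml.
have /andP[h1 h2] := floor_itv (complex.Re u); have /andP[h3 h4] := floor_itv (complex.Im u).
rewrite intrD in h2; rewrite intrD in h4.
set a := Num.floor (complex.Re u) in h1 h2 *; set b := Num.floor (complex.Im u) in h3 h4 *.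
move=> /andP[k1 k2] /andP[k3 k4].
have pz : p%:R = p%:Z%:~R :> R by [].
have l1 : x.1 < a + 1 + 4 * p%:Z by rewrite -(ltr_int R) !intrD intrM /=; rewrite pz in k1; lra.
have l2 : a < x.1 + 4 * p%:Z by rewrite -(ltr_int R) !intrD intrM /=; rewrite pz in k2; lra.
have l3 : x.2 < b + 1 + 4 * p%:Z by rewrite -(ltr_int R) !intrD intrM /=; rewrite pz in k3; lra.
have l4 : b < x.2 + 4 * p%:Z by rewrite -(ltr_int R) !intrD intrM /=; rewrite pz in k4; lra.
rewrite /window mem_box /half_window.
move: l1 l2 l3 l4; move: (x.1) (x.2) a b {h1 h2 h3 h4 k1 k2 k3 k4} => x1 x2 a b l1 l2 l3 l4.
lia.
Qed.

Lemma sum_bump_le p u (s : seq (int * int)) : (0 < p)%N -> uniq s ->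
  \sum_(x <- s) bump p u x <= window_mass p + 242 * p%:R.
Proof.
move=> p0 us.
have := sum_window_near_mass p u p0; rewrite ler_norml => /andP[_].
rewrite lerBlDl; apply: le_trans.
apply: ler_sum_support => //; first exact: uniq_box.
  by move=> x; exact: bump_ge0.
by move=> x /window_support + _; exact.
Qed.

Lemma tent_sum_le p w : (0 < p)%N -> tent_sum p w <= f w.
Proof.
move=> p0; rewrite /tent_sum mulrC ler_pdivrMr ?denominator_gt0//.
set s := box _ _ _; set u := _%:C * w.
apply: (@le_trans _ _ (\sum_(x <- s) f w * bump p u x)).
  apply: ler_sum => x _; have [->|b0] := eqVneq (bump p u x) 0; first by rewrite !mulr0.
  by rewrite ler_wpM2r ?bump_ge0// local_inf_le// bump_node_support.
by rewrite -mulr_sumr ler_wpM2l// sum_bump_le// uniq_box.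
Qed.

Lemma tent_sum_ge0 p w : (0 < p)%N -> 0 <= tent_sum p w.
Proof.
move=> p0; rewrite mulr_ge0 ?invr_ge0 ?(ltW (denominator_gt0 p p0))//.
by apply: sumr_ge0 => x _; rewrite mulr_ge0 ?local_inf_ge0 ?bump_ge0.
Qed.

Lemma window_in_grid p w : (0 < p)%N -> nc w <= p%:R ->
  let u := (4 * p%:R ^+ 2)%:C * w in
  {subset window p (Num.floor (complex.Re u)) (Num.floor (complex.Im u)) <=
    box (- (16 * p ^ 3)%:Z) (- (16 * p ^ 3)%:Z) (32 * p ^ 3).+1}.
Proof.
move=> p0 wp u x; rewrite /window !mem_box.
have P1 : 1 <= p%:R :> R by rewrite (ler_nat R 1).
have hu : nc u <= 4 * p%:R ^+ 3.
  rewrite /u normc_scale ?mulr_ge0 ?sqr_ge0// [_ ^+ 3]exprSr mulrA ler_wpM2l// mulr_ge0// sqr_ge0.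
have ha : `|complex.Re u| <= (4 * p ^ 3)%N%:R.
  by apply: le_trans (ler_abs_Re _ _) _; rewrite natrM natrX.
have hb : `|complex.Im u| <= (4 * p ^ 3)%N%:R.
  by apply: le_trans (ler_abs_Im _ _) _; rewrite natrM natrX.
have fl (y : R) (N : nat) : `|y| <= N%:R -> - N%:Z <= Num.floor y /\ Num.floor y <= N%:Z.
  rewrite ler_norml => /andP[y1 y2]; split.
    by rewrite floor_ge_int mulrNz.
  by rewrite -(ler_int R); apply: le_trans y2; exact: floor_le.
have [a1 a2] := fl _ _ ha; have [b1 b2] := fl _ _ hb.
have p3 : (p <= p ^ 3)%N by rewrite -{1}(expn1 p) leq_pexp2l.
rewrite /half_window.
move: (p ^ 3)%N p3 a1 a2 b1 b2 {ha hb hu} => q; lia.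
Qed.

Lemma error_absorption (v e p m : R) : 0 <= v -> 0 <= e -> 0 <= p ->
  v * 2000 <= p * e -> p ^+ 2 / 2 <= m ->
  (v - e) * (m + 242 * p) <= (v - e / 2) * (m - 242 * p).
Proof.
move=> v0 e0 p0 vp pm.
have h : v * 484 * p <= e / 2 * m.
  have : v * 2000 * p <= p * e * p by rewrite ler_wpM2r.
  have : e * (p ^+ 2 / 2) <= e * m by rewrite ler_wpM2l.
  by rewrite expr2; nra.
by nra.
Qed.

(** Near [w] the local infima are close to [f w], and the tents that see [w] sum
    up to [window_mass] up to a relative error [O (1 / p)]. *)
Lemma tent_sum_cvg w e : 0 < e ->
  exists p0, forall p, (p0 <= p)%N -> (0 < p)%N -> f w - e <= tent_sum p w.
Proof.
move=> e0; have e2e : e / 2 <= e by lra.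
have /continuous_complexP/(_ w (e / 2)) := cf.
move=> /(_ (divr_gt0 e0 (ltr0n _ 2)))[dl dl0 Hdl].
(* The three bounds put [w] in the disc covered by the lattice, the discs of the
   local infima in the ball of radius [dl], and [484 * p * f w] below
   [e / 2 * window_mass p]. *)
pose p0 := maxn (Num.truncn (nc w)).+1
  (maxn (Num.truncn (2 / dl)).+1 (Num.truncn (f w * 2000 / e)).+1).
exists p0 => p pp p_gt0.
have P0 : 0 < p%:R :> R by rewrite ltr0n.
have gen (y : R) : ((Num.truncn y).+1 <= p)%N -> y < p%:R.
  by move=> h; apply: lt_le_trans (truncnS_gt _) _; rewrite ler_nat.
move: pp; rewrite /p0 !geq_max => /and3P[/gen wp /gen dp /gen fp].
have [fe|fe] := leP (f w - e / 2) 0.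
  by apply: le_trans (le_trans _ fe) (tent_sum_ge0 _ _ p_gt0); rewrite lerD2l lerN2.
rewrite /tent_sum mulrC ler_pdivlMr ?denominator_gt0//.
set s := box _ _ _; set u := _%:C * w.
set W := window p (Num.floor (complex.Re u)) (Num.floor (complex.Im u)).
have W1 : \sum_(x <- W) bump p u x <= \sum_(x <- s) bump p u x.
  apply: ler_sum_support; rewrite ?uniq_box// => x; first exact: bump_ge0.
  by move=> _; apply: window_in_grid => //; exact: ltW.
have := sum_window_near_mass p u p_gt0; rewrite ler_norml => /andP[W2 _].
apply: (@le_trans _ _ (\sum_(x <- s) (f w - e / 2) * bump p u x)); last first.
  apply: ler_sum => x _; have [->|b0] := eqVneq (bump p u x) 0; first by rewrite !mulr0.
  rewrite ler_wpM2r ?bump_ge0// local_inf_ge// => v vx.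
  have wx := bump_node_support p w x p_gt0 b0.
  suff /Hdl : nc (v - w) < dl by rewrite ltr_distl => /andP[/ltW].
  have -> : v - w = (v - node p x) - (w - node p x) by ring.
  apply: le_lt_trans (ler_normcD _ _ _) _; rewrite normcN.
  apply: le_lt_trans (lerD vx wx) _.
  have -> : p%:R^-1 + p%:R^-1 = 2 / p%:R :> R by rewrite mulr_natl mulr2n.
  by rewrite ltr_pdivrMr// mulrC -ltr_pdivrMr.
rewrite -mulr_sumr.
have h1 := window_mass_large p p_gt0.
move: fp; rewrite ltr_pdivrMr// => fp.
set D := \sum_(x <- s) _ in W1 *; set Q := \sum_(x <- W) _ in W1 W2.
have DQ : window_mass p - 242 * p%:R <= D.
  by apply: le_trans W1; rewrite lerBrDr addrC in W2.
apply: (@le_trans _ _ ((f w - e / 2) * (window_mass p - 242 * p%:R))); last first.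
  by rewrite ler_wpM2l// ltW.
set m := window_mass p in h1 *.
exact: (error_absorption (f w) e p%:R m (f0 w) (ltW e0) (ltW P0) (ltW fp) h1).
Qed.

End approximation_from_below.

End tents.

Section weak_convergence_from_tents.
Context (R : realType).
Local Open Scope complex_scope.

Lemma ge0_integral_empirical n (z : n.-tuple (borelC R)) (h : borelC R -> \bar R) :
  (forall x, (0 <= h x)%E) -> measurable_fun setT h ->
  (\int[empirical z]_x h x = (n%:R^-1)%:E * \sum_(k < n) h (tnth z k))%E.
Proof.
move=> h0 mh; rewrite /empirical ge0_integral_mscale//=; congr (_ * _)%E.
rewrite ge0_integral_measure_sum//; apply: eq_bigr => k _.
by rewrite integral_dirac//= diracT mul1e (tnth_nth 0).
Qed.

Lemma integral_empirical n (z : n.-tuple (borelC R)) (f : R[i] -> R) :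
  continuous (f : R[i]^o -> R) ->
  (\int[empirical z]_x (f x)%:E = (average R z f)%:E)%E.
Proof.
move=> cf; have mf : measurable_fun [set: borelC R] f by exact: continuous_measurable_complex.
have mEf : measurable_fun [set: borelC R] (EFin \o f) by exact/measurable_EFinP.
rewrite integralE !ge0_integral_empirical//; last 2 first.
- exact: measurable_funeneg.
- exact: measurable_funepos.
rewrite (eq_bigr (fun k => (Num.max (f (tnth z k)) 0)%:E)); last first.
  by move=> k _; rewrite funeposE /= -EFin_max.
rewrite [X in (_ - _ * X)%E](eq_bigr (fun k => (Num.max (- f (tnth z k)) 0)%:E)); last first.
  by move=> k _; rewrite funenegE /= -EFin_max.
rewrite !sumEFin -!EFinM -EFinB -mulrBr -sumrB; congr (_ * _)%:E.
apply: eq_bigr => k _; set a := f _.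
by case: (leP a 0) => h; case: (leP (- a) 0) => h'; lra.
Qed.

Lemma averageD n (z : n.-tuple R[i]) (f h : R[i] -> R) :
  average R z (fun w => f w + h w) = average R z f + average R z h.
Proof. by rewrite /average big_split mulrDr. Qed.

Lemma averageZ n (z : n.-tuple R[i]) (a : R) (f : R[i] -> R) :
  average R z (fun w => a * f w) = a * average R z f.
Proof. by rewrite /average -mulr_sumr mulrCA. Qed.

Lemma averageB n (z : n.-tuple R[i]) (f h : R[i] -> R) :
  average R z (fun w => f w - h w) = average R z f - average R z h.
Proof. by rewrite /average sumrB mulrBr. Qed.

Lemma average_sum n (z : n.-tuple R[i]) (I : Type) (s : seq I) (F : I -> R[i] -> R) :
  average R z (fun w => \sum_(i <- s) F i w) = \sum_(i <- s) average R z (F i).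
Proof. by rewrite /average exchange_big/= mulr_sumr. Qed.

Lemma average_cst n (z : n.-tuple R[i]) (a : R) : (0 < n)%N -> average R z (fun=> a) = a.
Proof.
move=> n0; rewrite /average sumr_const card_ord -[X in _ * X]mulr_natl mulrA mulVf ?mul1r//.
by rewrite pnatr_eq0 -lt0n.
Qed.

Lemma ler_average n (z : n.-tuple R[i]) (f h : R[i] -> R) :
  (forall w, f w <= h w) -> average R z f <= average R z h.
Proof. by move=> fh; rewrite /average ler_wpM2l ?invr_ge0// ler_sum. Qed.

Lemma continuous_complex_cst (a : R) : continuous ((fun=> a) : R[i]^o -> R).
Proof.
by apply: (@continuous_complex_lipschitz _ _ 0) => z w; rewrite subrr normr0 mul0r.
Qed.

Lemma bump_lipschitz p (x : int * int) (z w : R[i]) : (0 < p)%N ->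
  `|bump R p ((4 * p%:R ^+ 2)%:C * w) x - bump R p ((4 * p%:R ^+ 2)%:C * z) x|
    <= 4 * p%:R * nc (w - z).
Proof.
move=> p0; rewrite !bump_node//; apply: le_trans (tent_lipschitz _ _ _) _.
rewrite -mulrBr normc_scale ?mulr_ge0// !mulrA (_ : 2 * 2 * p%:R = 4 * p%:R); last by ring.
rewrite ler_wpM2l ?mulr_ge0// (_ : _ - _ - _ = w - z)//; by ring.
Qed.

Lemma continuous_tent_sum (f : R[i] -> R) p : (forall w, 0 <= f w) -> (0 < p)%N ->
  continuous (tent_sum R f p : R[i]^o -> R).
Proof.
move=> f0 p0; set s := box (- (16 * p ^ 3)%:Z) (- (16 * p ^ 3)%:Z) (32 * p ^ 3).+1.
pose D := (window_mass R p + 242 * p%:R)^-1.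
have D0 : 0 <= D by rewrite invr_ge0; apply/ltW/denominator_gt0.
apply: (@continuous_complex_lipschitz _ _
  (D * \sum_(k <- s) local_inf R f p k * (4 * p%:R))) => z w.
rewrite /tent_sum -mulrBr -sumrB normrM (ger0_norm D0) -!mulrA ler_wpM2l//.
rewrite mulr_suml; apply: le_trans (ler_norm_sum _ _ _) _; apply: ler_sum => k _.
rewrite -mulrBr normrM (ger0_norm (local_inf_ge0 _ _ f0 _ _)) -mulrA.
by rewrite ler_wpM2l ?local_inf_ge0// bump_lipschitz.
Qed.

Variables (x y : forall n, n.-tuple (borelC R)) (mu : {measure set (borelC R) -> \bar R}).
Hypothesis xmu : weak_cvg (fun n => empirical (x n)) mu.
Hypothesis xy : forall (k : int * int) (N M : nat), (0 < N)%N -> (0 < M)%N ->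
  average R (y n) (fun w => truncated_log R (M%:R^-1) (w - N%:R^-1%:C * gauss R k)) -
  average R (x n) (fun w => truncated_log R (M%:R^-1) (w - N%:R^-1%:C * gauss R k))
    @[n --> \oo] --> (0 : R).

(** Testing against [1] makes [mu] a probability, hence bounded functions
    integrable. *)
Lemma limit_mass1 : mu setT = 1%E.
Proof.
have c1 : continuous ((fun=> 1 : R) : R[i]^o -> R) by exact: continuous_complex_cst.
have b1 : exists M, forall z : R[i]^o, `|(1 : R)| <= M by exists 1; rewrite normr1.
have := xmu _ c1 b1.
have -> : (\int[mu]_z 1%:E = mu setT)%E.
  by have := integral_cst mu measurableT 1%E; rewrite mul1e.
move=> /(cvg_lim (@ereal_hausdorff R)) <-; apply: (cvg_lim (@ereal_hausdorff R)).
apply: cvg_near_cst; near=> n.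
rewrite (integral_empirical _ _ _ c1) average_cst//.
by near: n; exists 1%N.
Unshelve. all: by end_near. Qed.

Lemma bounded_integrable (f : R[i] -> R) (M : R) : continuous (f : R[i]^o -> R) ->
  (forall z, `|f z| <= M) -> mu.-integrable setT (EFin \o f).
Proof.
move=> cf fM.
have mf : measurable_fun [set: borelC R] (EFin \o f).
  by apply/measurable_EFinP; exact: continuous_measurable_complex.
apply/integrableP; split => //.
apply: (@le_lt_trans _ _ (\int[mu]_z (cst M%:E z))%E).
  apply: ge0_le_integral => //=; last by move=> z _; rewrite lee_fin.
  apply/measurable_EFinP; apply: measurableT_comp => //.
  exact: continuous_measurable_complex.
rewrite integral_cst// limit_mass1 mule1 ltry//.
Qed.

Lemma average_cvg (f : R[i] -> R) (M : R) : continuous (f : R[i]^o -> R) ->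
  (forall z, `|f z| <= M) ->
  average R (x n) f @[n --> \oo] --> (fine (\int[mu]_z (f z)%:E)%E : R).
Proof.
move=> cf fM.
have := xmu _ cf (ex_intro _ M fM).
rewrite -[X in _ --> X -> _]fineK; last first.
  by apply: integrable_fin_num => //; exact: bounded_integrable fM.
under eq_fun do rewrite (integral_empirical _ _ _ cf).
by move/fine_cvg.
Qed.

Lemma average_tent_sum_cvg (f : R[i] -> R) p : (0 < p)%N ->
  average R (y n) (tent_sum R f p) - average R (x n) (tent_sum R f p) @[n --> \oo] --> (0 : R).
Proof.
move=> p0; have P0 : 0 < p%:R :> R by rewrite ltr0n.
have E n (z : n.-tuple R[i]) : average R z (tent_sum R f p) =
  (window_mass R p + 242 * p%:R)^-1 *
  \sum_(k <- box (- (16 * p ^ 3)%:Z) (- (16 * p ^ 3)%:Z) (32 * p ^ 3).+1) local_inf R f p k *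
    (average R z (fun w => truncated_log R (p%:R^-1) (w - (4 * p ^ 2)%N%:R^-1%:C * gauss R k)) -
     average R z (fun w => truncated_log R ((2 * p)%N%:R^-1) (w - (4 * p ^ 2)%N%:R^-1%:C * gauss R k))).
  rewrite /tent_sum averageZ average_sum; congr (_ * _); apply: eq_bigr => k _.
  rewrite averageZ -averageB; congr (_ * (_ * _)); apply: eq_bigr => i _.
  rewrite bump_node// tent_scale; last by rewrite mulr_gt0.
  rewrite /node natrM natrX natrM; congr (truncated_log _ _ _ - _).
  by rewrite invfM mulrA divff ?mul1r.
set s := box _ _ _ in E; set D := _^-1 in E.
pose F k n := local_inf R f p k *
  ((average R (y n) (fun w => truncated_log R (p%:R^-1) (w - (4 * p ^ 2)%N%:R^-1%:C * gauss R k)) -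
    average R (x n) (fun w => truncated_log R (p%:R^-1) (w - (4 * p ^ 2)%N%:R^-1%:C * gauss R k))) -
   (average R (y n) (fun w => truncated_log R ((2 * p)%N%:R^-1) (w - (4 * p ^ 2)%N%:R^-1%:C * gauss R k)) -
    average R (x n) (fun w => truncated_log R ((2 * p)%N%:R^-1) (w - (4 * p ^ 2)%N%:R^-1%:C * gauss R k)))).
have F0 k : F k n @[n --> \oo] --> (0 : R).
  have N0 : (0 < 4 * p ^ 2)%N by rewrite muln_gt0 expn_gt0 p0.
  have M0 : (0 < 2 * p)%N by rewrite muln_gt0.
  have h := cvgB (xy k _ _ N0 p0) (xy k _ _ N0 M0).
  have hl : (fun=> local_inf R f p k) n @[n --> \oo] --> (local_inf R f p k : R).
    exact: cvg_cst.
  by have := cvgM hl (h _); rewrite subrr mulr0 => H; exact: H.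
have sF : \sum_(k <- s) F k n @[n --> \oo] --> (0 : R).
  elim: s {E} => [|k s IH].
    by under eq_fun do rewrite big_nil; exact: cvg_cst.
  under eq_fun do rewrite big_cons.
  by have := cvgD (F0 k) IH; rewrite addr0 => H; exact: H.
have hD : (fun=> D) n @[n --> \oo] --> D by exact: cvg_cst.
have H : (fun n => D * \sum_(k <- s) F k n) n @[n --> \oo] --> (0 : R).
  suff : (fun n => D * \sum_(k <- s) F k n) n @[n --> \oo] --> (D * 0 : R).
    by rewrite mulr0.
  exact: cvgM.
apply: cvg_trans H; apply: near_eq_cvg; apply: nearW => n /=.
rewrite !E -mulrBr -sumrB; apply: (congr1 (fun u => D * u)); apply: eq_bigr => k _.
rewrite /F; ring.
Qed.

(** The averages of [f] dominate those of its [tent_sum], whose limit is known,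
    and the limits of the latter tend to the integral of [f]. *)
Lemma average_lower_bound (f : R[i] -> R) (M e : R) : continuous (f : R[i]^o -> R) ->
  (forall z, 0 <= f z <= M) -> 0 < e ->
  \forall n \near \oo, fine (\int[mu]_z (f z)%:E)%E - e <= average R (y n) f.
Proof.
move=> cf fM e0.
have f0 z : 0 <= f z by have /andP[] := fM z.
have fM' z : `|f z| <= M by rewrite ger0_norm//; have /andP[] := fM z.
pose h i := tent_sum R f i.+1.
have h0 i z : 0 <= h i z by exact: tent_sum_ge0.
have hf i z : h i z <= f z by exact: tent_sum_le.
have ch i : continuous (h i : R[i]^o -> R) by exact: continuous_tent_sum.
have hM i z : `|h i z| <= M.
  by rewrite ger0_norm//; apply: le_trans (hf i z) _; have /andP[] := fM z.
have M0 : 0 <= M by apply: le_trans (fM' 0).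
have : (\int[mu]_z (h i z)%:E)%E @[i --> \oo] --> (\int[mu]_z (f z)%:E)%E.
  apply: (@dominated_cvg _ _ _ mu setT measurableT _ _ (cst M%:E)) => //.
  - by move=> i; apply/measurable_EFinP; exact: continuous_measurable_complex.
  - move=> z _; apply: cvg_EFin; first exact: nearW.
    apply/cvgrPdist_le => eps eps0.
    have [p0 Hp] := tent_sum_cvg R f f0 cf z eps eps0.
    near=> i; rewrite ger0_norm ?subr_ge0 ?hf// lerBlDr -lerBlDl.
    by apply: Hp => //; apply: leqW; near: i; exists p0.
  - have cc : continuous ((fun=> M) : R[i]^o -> R) by exact: continuous_complex_cst.
    by apply: (bounded_integrable (fun=> M) M) => // z; rewrite ger0_norm.
  - by move=> i z _; rewrite lee_fin.
have fin (u : R[i] -> R) : continuous (u : R[i]^o -> R) -> (forall z, `|u z| <= M) ->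
    (\int[mu]_z (u z)%:E)%E \is a fin_num.
  by move=> cu uM; apply: integrable_fin_num => //; exact: bounded_integrable uM.
have -> : (\int[mu]_z (f z)%:E = (fine (\int[mu]_z (f z)%:E))%:E)%E by rewrite fineK ?fin.
move=> /fine_cvg /cvgrPdist_le/(_ (e / 3)) /(_ (divr_gt0 e0 (ltr0n _ 3))) [i _ Hi].
have {Hi} /= := Hi i (leqnn i).
set I := fine _; set J := fine _ => IJ.
have := average_cvg (h i) M (ch i) (hM i); rewrite -/J.
move=> /cvgrPdist_le/(_ (e / 3)) /(_ (divr_gt0 e0 (ltr0n _ 3))) near1.
have := average_tent_sum_cvg f i.+1 isT.
move=> /cvgrPdist_le/(_ (e / 3)) /(_ (divr_gt0 e0 (ltr0n _ 3))) near2.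
near=> n.
have n1 : `|J - average R (x n) (h i)| <= e / 3 by near: n; exact: near1.
have n2 : `|0 - (average R (y n) (h i) - average R (x n) (h i))| <= e / 3 by near: n; exact: near2.
have n3 : average R (y n) (h i) <= average R (y n) f by exact: ler_average.
move: IJ n1 n2; rewrite !ler_norml => /andP[_ h1] /andP[_ h2] /andP[_ h3].
move: (average R (y n) f) (average R (y n) (h i)) (average R (x n) (h i)) n3 h1 h2 h3.
by move=> A1 A2 A3 n3 h1 h2 h3; clear -n3 h1 h2 h3; lra.
Unshelve. all: by end_near. Qed.

(** A lower bound for [M + f] and one for [M - f] enclose the averages of [f]. *)
Lemma weak_cvg_from_tents : weak_cvg (fun n => empirical (y n)) mu.
Proof.
move=> f cf [M fM].
have M0 : 0 <= M by apply: le_trans (fM 0).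
under eq_fun do rewrite (integral_empirical _ _ _ cf).
have fi := bounded_integrable f M cf fM.
have -> : (\int[mu]_z (f z)%:E = (fine (\int[mu]_z (f z)%:E))%:E)%E.
  by rewrite fineK// integrable_fin_num.
apply: cvg_EFin; first exact: nearW.
apply/cvgrPdist_le => e e0.
have cM : continuous ((fun=> M) : R[i]^o -> R) by exact: continuous_complex_cst.
have iM : mu.-integrable setT (EFin \o (fun=> M)).
  by apply: (bounded_integrable _ M cM) => z; rewrite ger0_norm.
have IM : (\int[mu]_z M%:E = M%:E)%E.
  by have := integral_cst mu measurableT M%:E; rewrite limit_mass1 mule1.
have c1 : continuous ((fun z => M + f z) : R[i]^o -> R).
  apply/continuous_complexP => z d d0; have /continuous_complexP/(_ z d d0)[dl dl0 H] := cf.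
  by exists dl => // w /H; rewrite (_ : M + f w - (M + f z) = f w - f z)//; ring.
have c2 : continuous ((fun z => M - f z) : R[i]^o -> R).
  apply/continuous_complexP => z d d0; have /continuous_complexP/(_ z d d0)[dl dl0 H] := cf.
  by exists dl => // w /H; rewrite (_ : M - f w - (M - f z) = - (f w - f z)) ?normrN//; ring.
have b1 z : 0 <= M + f z <= 2 * M.
  move: (f z) (fM z) => v; rewrite ler_norml => /andP[h1 h2].
  by clear -h1 h2; apply/andP; split; lra.
have b2 z : 0 <= M - f z <= 2 * M.
  move: (f z) (fM z) => v; rewrite ler_norml => /andP[h1 h2].
  by clear -h1 h2; apply/andP; split; lra.
have near1 := average_lower_bound _ _ _ c1 b1 e0.
have near2 := average_lower_bound _ _ _ c2 b2 e0.
have I1 : fine (\int[mu]_z (M + f z)%:E)%E = M + fine (\int[mu]_z (f z)%:E)%E.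
  rewrite (@integralD_EFin _ _ _ mu setT measurableT (fun=> M) f)//.
  by rewrite fineD ?integrable_fin_num// IM.
have I2 : fine (\int[mu]_z (M - f z)%:E)%E = M - fine (\int[mu]_z (f z)%:E)%E.
  rewrite integralB_EFin//.
  by rewrite fineB ?integrable_fin_num// IM.
near=> n.
have n0 : (0 < n)%N by near: n; exists 1%N.
have n1 : fine (\int[mu]_z (M + f z)%:E)%E - e <= average R (y n) (fun z => M + f z).
  by near: n; exact: near1.
have n2 : fine (\int[mu]_z (M - f z)%:E)%E - e <= average R (y n) (fun z => M - f z).
  by near: n; exact: near2.
move: n1 n2; rewrite I1 I2 averageD averageB average_cst// => n1 n2.
rewrite /= ler_norml.
move: (average R (y n) f) (fine _) n1 n2 => A I n1 n2.
by clear -n1 n2; apply/andP; split; lra.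
Unshelve. all: by end_near. Qed.

End weak_convergence_from_tents.

(** * All derivatives at once, outside an exceptional event *)

Section good_event.
Context (R : realType).
Local Open Scope complex_scope.
Variables (c : R[i]) (r0 : R).
Hypothesis r0_gt0 : 0 < r0.

(** The exponents are chosen for two purposes. The [candidates] radii are more
    numerous than the at most [n.+1 ^ 2] values that they must avoid and stay
    within [2 / n.+1] of [r0]. The exceptional probabilities, of order
    [n.+1 ^ 4 * n.+1 ^- 8] and [n.+1 ^ 2 / weight_cutoff n], are summable. *)
Definition spacing (n : nat) : R := n.+1%:R ^- 3.
Definition candidates (n : nat) : nat := (n.+1 ^ 2).+1.
Definition candidate_radius (n i : nat) : R := r0 + 2 * spacing n * i%:R.
Definition weight_cutoff (n : nat) : R := n.+1%:R ^+ 4.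
Definition exclusion_radius (E n : nat) : R := n.+1%:R ^- (E + 8).
Definition modulus_bound : R := nc c + r0 + 2.
(** The exponent is [E + 8 + 3 + 4 + 1], for the order of magnitude of
    [n * weight_cutoff n / (exclusion_radius E n * spacing n)]. *)
Definition step_bound (E n : nat) : R := 4 * modulus_bound * n.+1%:R ^+ (E + 16).

Lemma spacing_gt0 n : 0 < spacing n.
Proof. by rewrite invr_gt0 exprn_gt0// ltr0n. Qed.

Lemma spacing_le1 n : spacing n <= 1.
Proof.
by rewrite /spacing invf_le1 ?exprn_gt0 ?ltr0n// exprn_ege1// (ler_nat R 1).
Qed.

Lemma candidate_radius_bounds n (i : 'I_(candidates n)) :
  r0 <= candidate_radius n i /\ candidate_radius n i - r0 <= 2 / n.+1%:R.
Proof.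
have s0 := spacing_gt0 n; have n0 : 0 < n.+1%:R :> R by rewrite ltr0n.
rewrite /candidate_radius; split; first by rewrite lerDl mulr_ge0// mulr_ge0// ltW.
rewrite addrAC subrr add0r -mulrA ler_pM2l// -[leRHS]div1r ler_pdivlMr//.
have : i%:R <= (n.+1 ^ 2)%N%:R :> R by rewrite ler_nat -ltnS.
rewrite natrX => h.
rewrite /spacing -mulrA mulrC ler_pdivrMr ?exprn_gt0// mul1r [leRHS]exprSr.
by rewrite ler_wpM2r// ltW.
Qed.

Lemma candidate_radius_le n (i : 'I_(candidates n)) : (2 <= n)%N ->
  candidate_radius n i + 1 <= r0 + 2.
Proof.
move=> n2; have [_ h] := candidate_radius_bounds n i.
have h1 : 2 / n.+1%:R <= 1 :> R.
  by rewrite ler_pdivrMr ?ltr0n// mul1r (ler_nat R 2); lia.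
by have := le_trans h h1; lra.
Qed.

Lemma modulus_bound_ge2 : 2 <= modulus_bound.
Proof. by rewrite /modulus_bound; have := normc_ge0 R c; have := r0_gt0; lra. Qed.

Lemma circle_point_bounds n (i : 'I_(candidates n)) x : (2 <= n)%N ->
  nc (x - c) = candidate_radius n i -> nc x <= modulus_bound.
Proof.
move=> n2 xc; have h := candidate_radius_le n i n2.
rewrite (_ : x = (x - c) + c); last by ring.
by apply: le_trans (ler_normcD _ _ _) _; rewrite xc /modulus_bound; have := r0_gt0; lra.
Qed.

Lemma circle_error_le E n (i : 'I_(candidates n)) : (2 <= n)%N ->
  circle_error R (candidate_radius n i) (spacing n) <= ln (step_bound E n).
Proof.
move=> n2; have h := candidate_radius_le n i n2.
have [h1 _] := candidate_radius_bounds n i.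
have s0 := spacing_gt0 n; have s1 := spacing_le1 n.
have M2 := modulus_bound_ge2.
have n1 : 1 <= n.+1%:R :> R by rewrite (ler_nat R 1).
have rr := r0_gt0; rewrite /circle_error ler_ln ?posrE; last 2 first.
- by rewrite divr_gt0//; lra.
- by rewrite !mulr_gt0 ?exprn_gt0//; lra.
rewrite {2}/spacing invrK /step_bound; apply: ler_pM; try lra.
- by rewrite exprn_ge0.
- by rewrite /modulus_bound; have := normc_ge0 R c; have := r0_gt0; lra.
- by rewrite ler_weXn2l//; lia.
Qed.

Variables (E n m : nat) (k0 : 'I_n).
Variables (z : nat -> n.-tuple R[i]) (g : nat -> n.-tuple R)
  (points : 'I_(candidates n) -> n.-tuple R[i]).
Hypothesis n_ge2 : (2 <= n)%N.
Hypothesis spacing_le : spacing n <= r0.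
Hypothesis m_le_n : (m <= n)%N.
Hypothesis points_circle : forall i k, nc (tnth (points i) k - c) = candidate_radius n i.
Hypothesis points_prod : forall i w, \prod_(k < n) (w - tnth (points i) k) =
  (w - c) ^+ n - (candidate_radius n i ^+ n)%:C.
Hypothesis z_zeros : forall j, (j < m)%N ->
  zeros_with_multiplicity (circular_poly (z j) (g j.+1)) (z j.+1).
Hypothesis g_bounds : forall j k, (j < m)%N -> 0 < tnth (g j.+1) k <= weight_cutoff n.
Hypothesis far_from_critical : forall j i k, (j < m)%N -> exclusion_radius E n <
  `|tnth (g j.+1) k0 - critical_value R k0 (tnth (points i) k) (z j) (g j.+1)|.

(** The radius keeps the circle away from all zeros, and from the negative of
    one zero at each step, where the coefficient of the weight [k0] would
    vanish. *)
Lemma exists_separated_radius : exists i : 'I_(candidates n),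
  (forall j k, (j <= m)%N -> spacing n <= `|nc (tnth (z j) k - c) - candidate_radius n i|) /\
  (forall j, (j <= m)%N -> spacing n <= `|nc (- tnth (z j) k0 - c) - candidate_radius n i|).
Proof.
pose vals := [seq nc (tnth (z j) k - c) | j <- iota 0 m.+1, k <- enum 'I_n] ++
  [seq nc (- tnth (z j) k0 - c) | j <- iota 0 m.+1].
have sv : (size vals < candidates n)%N.
  rewrite size_cat size_allpairs size_map !size_iota size_enum_ord /candidates ltnS.
  by rewrite expnS expn1 addnC -mulnS leq_mul.
have [i _ Hi] := pigeonhole_radius R vals r0 (spacing n) (candidates n) (spacing_gt0 n) sv.
exists i; split => [j k jm|j jm]; apply: Hi; rewrite mem_cat; apply/orP.
  left; apply/allpairsP; exists (j, k); rewrite mem_iota mem_enum ltnS; split => //.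
by right; apply/mapP; exists j => //; rewrite mem_iota ltnS.
Qed.

Lemma log_potential_all_steps (i : 'I_(candidates n)) k :
  (forall j k, (j <= m)%N -> spacing n <= `|nc (tnth (z j) k - c) - candidate_radius n i|) ->
  (forall j, (j <= m)%N -> spacing n <= `|nc (- tnth (z j) k0 - c) - candidate_radius n i|) ->
  `|log_potential R (tnth (points i) k) (z m) - log_potential R (tnth (points i) k) (z 0%N)|
    <= m%:R * ln (step_bound E n).
Proof.
move=> hz hz0; set x := tnth _ _.
have xc : nc (x - c) = candidate_radius n i by exact: points_circle.
have far y : spacing n <= `|nc (y - c) - candidate_radius n i| -> spacing n <= nc (x - y).
  move=> h; apply: le_trans h _; rewrite -xc; apply: le_trans (ler_dist_normc _ _ _) _.
  by rewrite (_ : y - c - (x - c) = - (x - y)) ?normcN//; ring.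
have M2 := modulus_bound_ge2.
have n1 : 1 <= n.+1%:R :> R by rewrite (ler_nat R 1).
have np k' : 0 < n.+1%:R ^+ k' :> R by rewrite exprn_gt0//; lra.
have xM : nc x <= modulus_bound := circle_point_bounds n i x n_ge2 xc.
have step j : (j < m)%N ->
    `|log_potential R x (z j.+1) - log_potential R x (z j)| <= ln (step_bound E n).
  move=> jm.
  apply: (@log_potential_step R n k0 x (z j) (z j.+1) (g j.+1) modulus_bound
    (spacing n) (exclusion_radius E n) (weight_cutoff n)) => //.
  - exact: z_zeros.
  - exact: spacing_gt0.
  - by apply: le_trans (spacing_le1 n) _; lra.
  - by move=> l; apply/far/hz; exact: ltnW.
  - by move=> l; apply/far/hz.
  - by have := far _ (hz0 j (ltnW jm)); rewrite opprK.
  - by move=> l; have /andP[] := g_bounds j l jm.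
  - by move=> l; have /andP[] := g_bounds j l jm.
  - by rewrite invr_gt0.
  - exact: far_from_critical.
  - rewrite /step_bound /spacing invrK ler_wpM2l ?mulr_ge0//; first lra.
    by rewrite ler_weXn2l//; lia.
  - rewrite /step_bound /exclusion_radius /spacing /weight_cutoff -invfM -exprD.
    rewrite -!mulrA ler_wpM2l// ler_wpM2l//; first lra.
    rewrite ler_pdivlMr// -mulrA -exprD.
    apply: (@le_trans _ _ (n.+1%:R * n.+1%:R ^+ (4 + (E + 8 + 3)))).
      by rewrite ler_wpM2r// ?(ltW (np _))// ler_nat.
    by rewrite -exprS ler_weXn2l//; lia.
suff gen j : (j <= m)%N -> `|log_potential R x (z j) - log_potential R x (z 0%N)|
    <= j%:R * ln (step_bound E n) by exact: gen.
elim: j => [|j IH] jm; first by rewrite subrr normr0 mul0r.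
rewrite -(subrK (log_potential R x (z j)) (log_potential R x (z j.+1))) -addrA.
apply: le_trans (ler_normD _ _) _; rewrite -natr1 mulrDl mul1r [leRHS]addrC.
by apply: lerD; [exact: step|exact: IH (ltnW jm)].
Qed.

Lemma average_truncated_log_all_steps :
  `|average R (z m) (fun w => truncated_log R r0 (w - c)) -
    average R (z 0%N) (fun w => truncated_log R r0 (w - c))| <=
  (m%:R + 2) * ln (step_bound E n) / n%:R + 4 / (r0 * n.+1%:R).
Proof.
have [i [hz hz0]] := exists_separated_radius.
have n0 : (0 < n)%N by exact: ltnW.
have nR : 0 < n%:R :> R by rewrite ltr0n.
have s0 := spacing_gt0 n; have [h1 h2] := candidate_radius_bounds n i.
have sr : spacing n <= candidate_radius n i by exact: le_trans h1.
have lnK0 : 0 <= ln (step_bound E n).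
  apply: le_trans (circle_error_le E n i n_ge2).
  by rewrite ln_ge0// ler_pdivlMr//; have := r0_gt0; lra.
have := @average_truncated_log_step R n (z 0%N) (z m) (points i) c (candidate_radius n i)
  (spacing n) (m%:R * ln (step_bound E n)) (points_prod i) (points_circle i) n0 s0 sr
  (fun k => hz 0%N k (leq0n _)) (fun k => hz m k (leqnn _))
  (fun k => log_potential_all_steps i k hz hz0).
have radius (y : n.-tuple R[i]) : `|average R y (fun w => truncated_log R (candidate_radius n i) (w - c)) -
    average R y (fun w => truncated_log R r0 (w - c))| <= 2 / (r0 * n.+1%:R).
  rewrite -averageB /average normrM gtr0_norm ?invr_gt0//.
  rewrite ler_pdivrMl//; apply: le_trans (ler_norm_sum _ _ _) _.
  rewrite [leRHS]mulr_natl.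
  have -> : 2 / (r0 * n.+1%:R) *+ n = \sum_(k < n) 2 / (r0 * n.+1%:R).
    by rewrite sumr_const card_ord.
  apply: ler_sum => k _.
  apply: le_trans (truncated_log_lipschitz_radius _ _ _ _ r0_gt0 h1) _.
  have -> : 2 / (r0 * n.+1%:R) = 2 / n.+1%:R / r0 by rewrite invfM mulrA [RHS]mulrAC.
  by rewrite ler_wpM2r// invr_ge0 ltW.
have := radius (z m); have := radius (z 0%N).
have ce := circle_error_le E n i n_ge2.
have : 2 * circle_error R (candidate_radius n i) (spacing n) / n%:R <= 2 * ln (step_bound E n) / n%:R.
  by rewrite ler_wpM2r ?invr_ge0//; lra.
have -> : (m%:R + 2) * ln (step_bound E n) / n%:R =
    m%:R * ln (step_bound E n) / n%:R + 2 * ln (step_bound E n) / n%:R by ring.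
rewrite (_ : 4 / (r0 * n.+1%:R) = 2 / (r0 * n.+1%:R) + 2 / (r0 * n.+1%:R)); last first.
  by rewrite -mulrDl; congr (_ / _); ring.
set q := 2 / (r0 * _); set e1 := m%:R * _ / _; set e2 := 2 * ln _ / _; set b := 2 * _ / _.
move: (average _ (z m) _) (average _ (z 0%N) _) (average _ (z m) _) (average _ (z 0%N) _) => A A' B B'.
rewrite !ler_norml => H1 /andP[H2 H3] /andP[H4 H5] /andP[H6 H7].
by clear -H1 H2 H3 H4 H5 H6 H7; apply/andP; split; lra.
Qed.

End good_event.

(** * Probability of the exceptional events *)

Lemma ae_forall_countable d (T : measurableType d) (R : realType)
    (P : {measure set T -> \bar R}) (I : countType) (Q : I -> T -> Prop) :
  (forall i, {ae P, forall w, Q i w}) -> {ae P, forall w, forall i, Q i w}.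
Proof.
move=> h.
have : {ae P, forall w, forall n, if unpickle n is Some i then Q i w else True}.
  apply/ae_foralln => n; case: (unpickle n) => [i|]; first exact: h.
  exact: aeW.
by apply: filterS => w Hw i; have := Hw (pickle i); rewrite pickleK.
Qed.

Section exceptional_probability.
Context (R : realType) (d : measure_display) (T : measurableType d)
  (P : probability T R) (beta : R) (n m : nat)
  (Z : nat -> {RV P >-> n.-tuple (borelC R)}) (g : nat -> {RV P >-> n.-tuple R}).
Hypothesis icd : iterated_circular_derivatives beta m Z g.

Let weight (i : 'I_m * 'I_n) (w : T) : R := tnth (g i.1.+1 w) i.2.
Let initial (k : 'I_n) (w : T) : borelC R := tnth (Z 0%N w) k.
Let past (i0 : 'I_m * 'I_n) := rest_system _ _ _ _ _ _ _ _ weight initial i0.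

Let weight_gamma i : gamma_distributed P (beta / 2) (weight i).
Proof. by case: icd => h _ _ _; exact: h. Qed.

Lemma measurable_weight i : measurable_fun setT (weight i).
Proof.
have mg : measurable_fun setT (g i.1.+1) by exact: measurable_funPT.
by move/measurable_fun_tnthP : mg; exact.
Qed.

Lemma measurable_initial k : measurable_fun setT (initial k).
Proof.
have mz : measurable_fun setT (Z 0%N) by exact: measurable_funPT.
by move/measurable_fun_tnthP : mz; exact.
Qed.

(** The labelled zeros are almost surely iterated measurable functions of the
    initial points and of the weights of the earlier derivatives; the weight
    [i0] is only used for the derivative after [i0.1]. *)
Lemma zeros_past_measurable (i0 : 'I_m * 'I_n) j : (j <= i0.1)%N ->
  exists2 W : T -> n.-tuple (borelC R),
    measurable_fun setT (W : g_sigma_algebraType (past i0) -> n.-tuple (borelC R)) &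
    {ae P, forall w, Z j w = W w}.
Proof.
elim: j => [_|j IH ji].
  exists (Z 0%N); last by apply: aeW.
  apply/measurable_fun_tnthP => k; exact: measurable_rest_initial.
have [W mW ZW] := IH (ltnW ji).
have jm : (j < m)%N by apply: leq_trans ji (ltnW (ltn_ord i0.1)).
have [_ _ _ /(_ j jm)[[L mL ZL] _]] := icd.
exists (fun w => L (W w, g j.+1 w)).
  have mg : measurable_fun setT (g j.+1 : g_sigma_algebraType (past i0) -> n.-tuple R).
    apply/measurable_fun_tnthP => k.
    apply: (measurable_rest_weight _ _ _ _ _ _ _ _ weight initial i0 (Ordinal jm, k)).
    by apply: contraTneq ji => <- /=; rewrite ltnn.
  exact: (measurableT_comp mL (measurable_fun_pair mW mg)).
by apply: filterS2 ZW ZL => w hw hl; rewrite hl hw.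
Qed.

(** The critical value is a function of the past and of the other weights, hence
    independent of the weight [k0]. The event [F] is stated with the measurable
    version of the zeros, which makes it an event. *)
Lemma near_critical_probability (K s r : R) (x : R[i]) (j0 : 'I_m) (k0 : 'I_n) :
  (forall (X : T -> R) (s u r : R), gamma_distributed P (beta / 2) X ->
    measurable_fun setT X -> 0 < s -> 0 < r ->
    (P (X @^-1` `[u, (u + r)%R]) <= (K * (s `^ (beta / 2) + r / s))%:E)%E) ->
  0 < s -> 0 < r ->
  exists F : set T, [/\ measurable F,
    (P F <= (K * (s `^ (beta / 2) + 3 * r / s))%:E)%E &
    {ae P, forall w, `|tnth (g j0.+1 w) k0 - critical_value R k0 x (Z j0 w) (g j0.+1 w)| <= r ->
      F w}].
Proof.
move=> hK s0 r0; pose i0 := (j0, k0).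
have [W mW ZW] := zeros_past_measurable i0 j0 (leqnn _).
pose c w := critical_value R k0 x (W w) (g j0.+1 w).
have mc : measurable_fun setT (c : g_sigma_algebraType (past i0) -> R).
  apply: measurable_critical_value => // k kk0.
  apply: (measurable_rest_weight _ _ _ _ _ _ _ _ weight initial i0 (j0, k)).
  by apply: contraNneq kk0 => -[->].
have mpast A : <<s past i0 >> A -> measurable A.
  apply: smallest_sub; first exact: sigma_algebra_measurable.
  move=> B; apply: rest_system_measurable; [exact: measurable_weight|exact: measurable_initial].
have mcT : measurable_fun setT c.
  by move=> _ B mB; apply: mpast; exact: mc.
exists [set w | `|weight i0 w - c w| <= r]; split.
- have -> : [set w | `|weight i0 w - c w| <= r] = setT `&` (fun w => `|weight i0 w - c w|) @^-1` `]-oo, r].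
    by rewrite setTI; apply/seteqP; split => w; rewrite /= in_itv.
  suff : measurable_fun setT (fun w => `|weight i0 w - c w|) by apply.
  apply: measurableT_comp => //; apply: measurable_funB => //; exact: measurable_weight.
- apply: (independent_small_ball _ _ _ _ (past i0)) => //.
  + move=> B A mB sA; have [_ indw indwi _] := icd.
    by apply: (independent_weight_rest _ _ _ _ _ _ _ _ _ _ weight initial measurable_weight
      measurable_initial indw indwi i0).
  + exact: measurable_weight.
  + move=> u; apply: hK => //; [exact: measurable_weight|by rewrite mulr_gt0].
- by apply: filterS ZW => w hw; rewrite hw.
Qed.

Lemma weights_positive : {ae P, forall w, forall i, 0 < weight i w}.
Proof.
have h i : {ae P, forall w, 0 < weight i w}.
  exists (weight i @^-1` `]-oo, 0]); split.
  - by rewrite -[X in measurable X]setTI; exact: measurable_weight.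
  - exact: (gamma_distributed_le0 _ _ _ _ _ _ (weight_gamma i)).
  - by move=> w /= /negP; rewrite -leNgt in_itv.
exact: ae_forall_countable h.
Qed.

End exceptional_probability.

Section exceptional_events.
Context (R : realType) (d : measure_display) (T : measurableType d)
  (P : probability T R).

Lemma probability_union_bound (I : finType) (F : I -> set T) (p : R) :
  (forall i, measurable (F i)) -> (forall i, (P (F i) <= p%:E)%E) ->
  measurable (\bigcup_i F i) /\ (P (\bigcup_i F i) <= (#|I|%:R * p)%:E)%E.
Proof.
move=> mF Fp.
have -> : \bigcup_i F i = \big[setU/set0]_(i <- enum I) F i.
  rewrite -bigcup_seq; apply/seteqP; split => w [i _ Fi]; exists i => //=.
  by rewrite mem_enum.
rewrite cardE; elim: (enum I) => [|i s [mU IH]].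
  by rewrite big_nil measure0 mul0r.
rewrite big_cons; split; first exact: measurableU.
apply: le_trans (measureU2 _ _ _) _ => //.
by rewrite /= -natr1 mulrDl mul1r addrC EFinD leeD.
Qed.

Lemma invr_sqr_le (x : R) : 0 < x -> 1 <= x ->
  (x ^+ 2)^-1 <= 2 * (x * (x + 1))^-1.
Proof.
move=> x0 x1; have xx : 0 < x * (x + 1) by nra.
by rewrite -[leLHS]mul1r ler_pdivrMr ?exprn_gt0// mulrAC ler_pdivlMr//; nra.
Qed.

Variables (beta : R) (c : R[i]) (r0 : R).
Hypothesis beta0 : 0 < beta.
Hypothesis r0_gt0 : 0 < r0.

(** The exponent [E] absorbs the Hoelder exponent [beta / 2] of the Gamma
    distribution at [0]. The bound on the probability is written as a
    telescoping term, to be summed over [n]. *)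
Lemma exceptional_event : exists E : nat, exists2 C : R, 0 <= C &
  forall (n m : nat) (Z : nat -> {RV P >-> n.-tuple (borelC R)})
    (g : nat -> {RV P >-> n.-tuple R}),
  (2 <= n)%N -> (m <= n)%N -> spacing R n <= r0 ->
  iterated_circular_derivatives beta m Z g ->
  exists F : set T, [/\ measurable F,
    (P F <= (C * (n.+1%:R^-1 - n.+2%:R^-1))%:E)%E &
    {ae P, forall w, ~ F w ->
      `|average R (Z m w) (fun v => truncated_log R r0 (v - c)) -
        average R (Z 0%N w) (fun v => truncated_log R r0 (v - c))| <=
      (m%:R + 2) * ln (step_bound R c r0 E n) / n%:R + 4 / (r0 * n.+1%:R)}].
Proof.
have a0 : 0 < beta / 2 by rewrite divr_gt0.
have [K1 K10 hK1] := gamma_small_ball R (beta / 2) a0 d T P.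
have [K2 K20 hK2] := gamma_tail R (beta / 2) a0 d T P.
(* This makes [s `^ (beta / 2)] at most [n.+1 ^- 8] for [s = n.+1 ^- E]. *)
pose E := (Num.truncn (8 / (beta / 2))).+1.
exists E, (2 * (8 * K1 + K2)); first by rewrite mulr_ge0// addr_ge0 ?mulr_ge0// ltW.
move=> n m Z g n2 mn sr icd.
have n0 : (0 < n)%N by exact: ltnW.
pose k0 : 'I_n := Ordinal n0.
set N : R := n.+1%:R.
have N1 : 1 <= N by rewrite (ler_nat R 1).
have N0 : 0 < N by lra.
pose s : R := N ^- E.
have s0 : 0 < s by rewrite invr_gt0 exprn_gt0.
have r_gt0 : 0 < exclusion_radius R E n by rewrite invr_gt0 exprn_gt0.
have sa : s `^ (beta / 2) <= N ^- 8.
  rewrite /s -powR_mulrn ?(ltW N0)// -powRN -powRrM -[leRHS]powR_inv1 ?exprn_ge0 ?(ltW N0)//.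
  rewrite -powR_mulrn ?(ltW N0)// -powRrM ler_powR// mulrN1 mulNr lerN2.
  have : 8 / (beta / 2) <= E%:R by apply: ltW; exact: truncnS_gt.
  by rewrite ler_pdivrMr.
have rs : exclusion_radius R E n / s = N ^- 8.
  by rewrite /exclusion_radius /s invrK exprD invfM mulrAC mulVf ?mul1r// expf_neq0// gt_eqF.
have points (i : 'I_(candidates n)) := circle_points R c (candidate_radius R r0 n i) n
  (ltW (lt_le_trans r0_gt0 (candidate_radius_bounds R r0 n i).1)) n0.
have /choice[pt Hpt] := points.
pose I : finType := ('I_m * 'I_(candidates n) * 'I_n)%type.
have /choice[F HF] : forall x : I, exists F : set T, [/\ measurable F,
    (P F <= (4 * K1 * N ^- 8)%:E)%E &
    {ae P, forall w, `|tnth (g x.1.1.+1 w) k0 -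
        critical_value R k0 (tnth (pt x.1.2) x.2) (Z x.1.1 w) (g x.1.1.+1 w)|
        <= exclusion_radius R E n -> F w}].
  move=> x; have [F [mF PF aF]] := near_critical_probability R d T P beta n m Z g icd K1 s
    (exclusion_radius R E n) (tnth (pt x.1.2) x.2) x.1.1 k0 hK1 s0 r_gt0.
  exists F; split => //; apply: le_trans PF _; rewrite lee_fin -[3 * _ / _]mulrA rs.
  rewrite (_ : 4 * K1 * N ^- 8 = K1 * (4 * N ^- 8)); last by ring.
  rewrite ler_pM2l// (_ : 4 * N ^- 8 = N ^- 8 + 3 * N ^- 8); last by ring.
  by rewrite lerD2r.
pose X (jk : 'I_m * 'I_n) (w : T) := tnth (g jk.1.+1 w) jk.2.
pose G jk := X jk @^-1` `]weight_cutoff R n, +oo[.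
have mX jk : measurable_fun setT (X jk) by exact: (measurable_weight R d T P n m g jk).
have mG jk : measurable (G jk) by rewrite -[G jk]setTI; exact: mX.
have PG jk : (P (G jk) <= (K2 / N ^+ 4)%:E)%E.
  apply: hK2; [by case: icd => h _ _ _; exact: h|exact: mX|by rewrite exprn_gt0].
have [mUF PUF] := probability_union_bound _ F (4 * K1 * N ^- 8)
  (fun x => let: And3 h _ _ := HF x in h) (fun x => let: And3 _ h _ := HF x in h).
have [mUG PUG] := probability_union_bound _ G (K2 / N ^+ 4) mG PG.
exists (\bigcup_x F x `|` \bigcup_jk G jk); split.
- exact: measurableU.
- apply: le_trans (measureU2 _ _ _) _ => //.
  apply: le_trans (leeD PUF PUG) _; rewrite -EFinD lee_fin !card_prod !card_ord.
  have -> : N^-1 - n.+2%:R^-1 = (N * (N + 1))^-1.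
    by rewrite -[n.+2%:R]natr1 -/N; field; apply/andP; split; rewrite gt_eqF//; lra.
  have nN : n%:R <= N by rewrite ler_nat.
  have mN : m%:R <= N by rewrite ler_nat leqW.
  have cN : (candidates n)%:R <= 2 * N ^+ 2.
    rewrite /candidates -natr1 natrX -/N [2 * _]mulr_natl mulr2n lerD2l.
    by rewrite exprn_ege1.
  have mn2 : m%:R * n%:R <= N ^+ 2 by rewrite expr2 ler_pM.
  have mcn : m%:R * (candidates n)%:R * n%:R <= 2 * N ^+ 4.
    rewrite mulrAC (_ : 2 * N ^+ 4 = N ^+ 2 * (2 * N ^+ 2)); last by ring.
    by rewrite ler_pM// mulr_ge0.
  have NN : (N ^+ 2)^-1 <= 2 * (N * (N + 1))^-1.
    by move: {+}N N0 N1 => x x0 x1; exact: invr_sqr_le.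
  have N48 : N ^+ 4 * N ^- 8 <= N ^- 2.
    rewrite -(exprVn N 8) -(exprVn N 2) -[X in X * _]invrK -exprVn ler_pdivrMl ?exprn_gt0 ?invr_gt0//.
    rewrite -exprD ler_wiXn2l// ?invr_ge0 ?(ltW N0)//.
    by rewrite invf_le1.
  have N24 : N ^+ 2 * (N ^+ 4)^-1 = N ^- 2 by field; rewrite gt_eqF.
  rewrite !natrM.
  have t1 : m%:R * (candidates n)%:R * n%:R * (4 * K1 * N ^- 8) <= 8 * K1 * N ^- 2.
    apply: (@le_trans _ _ (2 * N ^+ 4 * (4 * K1 * N ^- 8))).
      by rewrite ler_wpM2r// !mulr_ge0// ?invr_ge0 ?exprn_ge0// ltW.
    rewrite (_ : 2 * N ^+ 4 * (4 * K1 * N ^- 8) = 8 * K1 * (N ^+ 4 * N ^- 8)); last by ring.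
    by rewrite ler_pM2l// mulr_gt0.
  have t2 : m%:R * n%:R * (K2 / N ^+ 4) <= K2 * N ^- 2.
    apply: (@le_trans _ _ (N ^+ 2 * (K2 / N ^+ 4))).
      by rewrite ler_wpM2r// divr_ge0 ?exprn_ge0 ?ltW.
    by rewrite mulrCA N24.
  apply: le_trans (lerD t1 t2) _; rewrite -mulrDl [2 * (_ + _)]mulrC -mulrA.
  by rewrite ler_wpM2l// addr_ge0 ?mulr_ge0// ltW.
- have zeros : {ae P, forall w, forall j : 'I_m,
      zeros_with_multiplicity (circular_poly (Z j w) (g j.+1 w)) (Z j.+1 w)}.
    apply: ae_forall_countable => j; have [_ _ _ /(_ j (ltn_ord j))[_]] := icd; exact.
  have crit := @ae_forall_countable d T R P I _ (fun x => let: And3 _ _ h := HF x in h).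
  have pos := weights_positive R d T P beta n m Z g icd.
  apply: filterS3 zeros crit pos => w zw cw pw /not_orP[nF nG].
  apply: (average_truncated_log_all_steps R c r0 r0_gt0 E n m k0 (fun j => Z j w)
    (fun j => g j w) pt) => //.
  + by move=> i; have [] := Hpt i.
  + by move=> i; have [] := Hpt i.
  + by move=> j jm; exact: zw (Ordinal jm).
  + move=> j k jm; rewrite (pw (Ordinal jm, k))/= leNgt; apply/negP => h; apply: nG.
    by exists (Ordinal jm, k) => //; rewrite /G /X /= in_itv/= andbT.
  + move=> j i k jm; rewrite ltNge; apply/negP => h; apply: nF.
    by exists (Ordinal jm, i, k) => //; exact: cw.
Qed.

End exceptional_events.

(** * Almost sure comparison of the first and last zeros *)

Section borel_cantelli.
Context (R : realType) (d : measure_display) (T : measurableType d)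
  (P : probability T R).

Lemma ae_eventually_not (F : nat -> set T) (C : R) : 0 <= C ->
  (forall n, measurable (F n)) ->
  (forall n, (P (F n) <= (C * (n.+1%:R^-1 - n.+2%:R^-1))%:E)%E) ->
  {ae P, forall w, \forall n \near \oo, ~ F n w}.
Proof.
move=> C0 mF PF.
have mL : measurable (lim_sup_set F).
  by apply: bigcap_measurable => // n _; apply: bigcup_measurable => k _.
exists (lim_sup_set F); split => //; last first.
  move=> w /= nw n _; apply: contrapT => h; apply: nw; exists n => // k /= nk Fk.
  by apply: h; exists k.
apply: lim_sup_set_cvg0 => //.
apply: (@le_lt_trans _ _ C%:E); last exact: ltry.
apply: (@le_trans _ _ (\sum_(n <oo) (C * (n.+1%:R^-1 - n.+2%:R^-1))%:E)%E).
  by apply: lee_nneseries => [n _ _|n _]; [exact: measure_ge0|exact: PF].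
have pos n : 0 <= C * (n.+1%:R^-1 - n.+2%:R^-1).
  by rewrite mulr_ge0// subr_ge0 lef_pV2 ?posrE ?ltr0n// ler_nat.
apply: lime_le; first by apply: is_cvg_nneseries => n _ _; rewrite lee_fin.
apply: nearW => n; rewrite sumEFin lee_fin -mulr_sumr ler_piMr//.
suff -> : \sum_(0 <= i < n) (i.+1%:R^-1 - i.+2%:R^-1) = 1 - n.+1%:R^-1 :> R.
  by rewrite gerBl invr_ge0.
elim: n => [|n IH]; first by rewrite big_geq// invr1 subrr.
by rewrite big_nat_recr//= IH addrA subrK.
Qed.

Variables (beta : R) (m : nat -> nat)
  (Z : forall n : nat, nat -> {RV P >-> n.-tuple (borelC R)})
  (g : forall n : nat, nat -> {RV P >-> n.-tuple R}).
Hypothesis beta0 : 0 < beta.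
Hypothesis m_ge1 : forall n : nat, (2 <= n)%N -> (1 <= m n)%N.
Hypothesis icd : forall n : nat, (2 <= n)%N ->
  iterated_circular_derivatives beta (m n) (Z n) (g n).
Hypothesis growth : (m n)%:R / (n%:R / ln n%:R) @[n --> \oo] --> (0 : R).

Lemma ln_ge_half n : (2 <= n)%N -> 2^-1 <= ln (n%:R : R).
Proof.
move=> n2; apply: le_trans (ln2_ge R) _.
by rewrite ler_ln ?posrE ?ltr0n// ?(ltnW n2)// (ler_nat R 2).
Qed.

Lemma near_m_le : \forall n \near \oo, (m n <= n)%N.
Proof.
move/cvgrPdist_le : growth => /(_ (2^-1)) /(_ _) near1.
near=> n.
have n2 : (2 <= n)%N by near: n; exists 2%N.
have : `|0 - (m n)%:R / (n%:R / ln n%:R)| <= 2^-1 :> R.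
  by near: n; apply: near1; rewrite invr_gt0.
have l2 := ln_ge_half n n2.
have l0 : 0 < ln (n%:R : R) by lra.
have n0 : 0 < n%:R :> R by rewrite ltr0n ltnW.
rewrite sub0r normrN ger0_norm; last by rewrite divr_ge0// divr_ge0// ltW.
rewrite ler_pdivrMr ?divr_gt0// mulrA ler_pdivlMr// => h.
rewrite -(ler_nat R).
have : (m n)%:R * 2^-1 <= (m n)%:R * ln n%:R :> R by rewrite ler_wpM2l.
by lra.
Unshelve. all: by end_near. Qed.

Lemma near_spacing_le (r : R) : 0 < r -> \forall n \near \oo, spacing R n <= r.
Proof.
move=> r0; near=> n.
have h : `|0 - harmonic n| <= r.
  near: n; move: r r0; apply/cvgrPdist_le; exact: cvg_harmonic.
have hr : harmonic n <= r by move: h; rewrite sub0r normrN; exact: le_trans (ler_norm _).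
apply: le_trans hr.
rewrite /harmonic/= /spacing lef_pV2 ?posrE ?exprn_gt0 ?ltr0n//.
by rewrite -[leLHS]expr1 ler_weXn2l// (ler_nat R 1).
Unshelve. all: by end_near. Qed.

(** [ln n] is bounded below for [n >= 2], so it absorbs the constants. *)
Lemma step_error_le (c : R[i]) (r : R) (E n : nat) : 0 < r -> (2 <= n)%N ->
  ((m n)%:R + 2) * ln (step_bound R c r E n) / n%:R <=
  6 * (ln (4 * modulus_bound R c r) + (E + 16)%:R) * ((m n)%:R / (n%:R / ln n%:R)).
Proof.
move=> r0 n2.
have M2 := modulus_bound_ge2 R c r r0.
have l2 := ln_ge_half n n2.
have n0 : 0 < n%:R :> R by rewrite ltr0n ltnW.
have m1 : 1 <= (m n)%:R :> R by rewrite (ler_nat R 1) m_ge1.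
have L0 : 0 <= ln (4 * modulus_bound R c r) by rewrite ln_ge0//; lra.
have lnS : ln (n.+1%:R : R) <= 2 * ln n%:R.
  rewrite mulr_natl -lnXn// ler_ln ?posrE ?exprn_gt0// -natrX ler_nat.
  by rewrite expnS expn1; nia.
have -> : ln (step_bound R c r E n) = ln (4 * modulus_bound R c r) + (E + 16)%:R * ln n.+1%:R.
  rewrite /step_bound lnM ?posrE ?exprn_gt0 ?ltr0n//; last by lra.
  by rewrite lnXn ?ltr0n//; congr (_ + _); rewrite mulr_natl.
rewrite invf_div mulrCA !mulrA; rewrite ler_wpM2r ?invr_ge0 ?(ltW n0)//.
have E0 : 0 <= (E + 16)%:R :> R by [].
set L := ln (4 * _) in L0 *; set e := (E + 16)%:R in E0 *; set l := ln n%:R in l2 lnS *.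
set l' := ln n.+1%:R in lnS *; set k := (m n)%:R in m1 *.
apply: (@le_trans _ _ (3 * k * (2 * L * l + e * (2 * l)))).
  apply: ler_pM; [lra| | lra |].
  - by rewrite addr_ge0// mulr_ge0// ln_ge0// (ler_nat R 1).
  - apply: lerD; last by rewrite ler_wpM2l.
    by nra.
by rewrite (_ : 3 * k * (2 * L * l + e * (2 * l)) = 6 * (L + e) * l * k)//; [lra|ring].
Qed.

Lemma ae_average_truncated_log_cvg (c : R[i]) (r : R) : 0 < r ->
  {ae P, forall w,
    average R (Z n (m n) w) (fun v => truncated_log R r (v - c)) -
    average R (Z n 0%N w) (fun v => truncated_log R r (v - c)) @[n --> \oo] --> (0 : R)}.
Proof.
move=> r0; have [E [C C0 HE]] := exceptional_event R d T P beta c r beta0 r0.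
pose good n := [&& (2 <= n)%N, (m n <= n)%N & spacing R n <= r].
have /choice[F HF] : forall n, exists F : set T, [/\ measurable F,
    (P F <= (C * (n.+1%:R^-1 - n.+2%:R^-1))%:E)%E &
    {ae P, forall w, good n -> ~ F w ->
      `|average R (Z n (m n) w) (fun v => truncated_log R r (v - c)) -
        average R (Z n 0%N w) (fun v => truncated_log R r (v - c))| <=
      ((m n)%:R + 2) * ln (step_bound R c r E n) / n%:R + 4 / (r * n.+1%:R)}].
  move=> n; have [/and3P[n2 mn sr]|bad] := boolP (good n).
    have [F [mF PF aF]] := HE n (m n) (Z n) (g n) n2 mn sr (icd n n2).
    by exists F; split => //; apply: filterS aF => w h _.
  exists set0; split => //; last by apply: aeW => w /= gn; case/negP: bad.
  rewrite measure0 lee_fin mulr_ge0// subr_ge0 lef_pV2 ?posrE ?ltr0n// ler_nat//.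
have evF : {ae P, forall w, \forall n \near \oo, ~ F n w}.
  by apply: (ae_eventually_not F C C0) => n; have [] := HF n.
have bnd := @ae_forall_countable d T R P nat _ (fun n => let: And3 _ _ h := HF n in h).
apply: filterS2 evF bnd => w nF hb.
pose D := 6 * (ln (4 * modulus_bound R c r) + (E + 16)%:R).
have v0 : D * ((m n)%:R / (n%:R / ln n%:R)) + 4 / r * harmonic n @[n --> \oo] --> (0 : R).
  rewrite [X in _ --> X](_ : _ = D * 0 + 4 / r * 0 :> R); last by rewrite !mulr0 addr0.
  apply: cvgD; apply: cvgM; [exact: cvg_cst|exact: growth|exact: cvg_cst|exact: cvg_harmonic].
apply/cvgrPdist_le => e e0.
move/cvgrPdist_le : v0 => /(_ e e0) ve.
near=> n.
have n2 : (2 <= n)%N by near: n; exists 2%N.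
have gn : good n.
  apply/and3P; split => //; first by near: n; exact: near_m_le.
  by near: n; exact: near_spacing_le.
have nFn : ~ F n w by near: n; exact: nF.
have vn : `|0 - (D * ((m n)%:R / (n%:R / ln n%:R)) + 4 / r * harmonic n)| <= e by near: n; exact: ve.
rewrite sub0r normrN; apply: le_trans (hb n gn nFn) _.
have {}vn : D * ((m n)%:R / (n%:R / ln n%:R)) + 4 / r * harmonic n <= e.
  by move: vn; rewrite sub0r normrN; exact: le_trans (ler_norm _).
apply: le_trans vn.
apply: lerD; first exact: step_error_le.
by rewrite /harmonic /= invfM mulrA.
Unshelve. all: by end_near. Qed.

End borel_cantelli.

Theorem theorem5 (R : realType) (d : measure_display) (T : measurableType d)
    (P : probability T R) (beta : R) (m : nat -> nat)
    (Z : forall n : nat, nat -> {RV P >-> n.-tuple (borelC R)})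
    (g : forall n : nat, nat -> {RV P >-> n.-tuple R})
    (mu : {measure set (borelC R) -> \bar R}) (B : R)
    (hbeta : 0 < beta)
    (hm : forall n : nat, (2 <= n)%N -> (1 <= m n)%N)
    (hZ : forall n : nat, (2 <= n)%N ->
      iterated_circular_derivatives beta (m n) (Z n) (g n))
    (hmu : {ae P, forall w, weak_cvg (fun n => empirical (Z n 0%N w)) mu})
    (hgrowth : (m n)%:R / (n%:R / ln n%:R) @[n --> \oo] --> (0 : R))
    (hB : 0 <= B)
    (hmin : (ereal_sup [set ((n%:R : R) `^ (- B))%:E *
               ereal_sup [set 'E_P[fun w => min_modulus (Z n j w)]
                         | j in [set j : nat | (j <= (m n).-1)%N]]
             | n in [set n : nat | (2 <= n)%N]] < +oo)%E) :
  {ae P, forall w, weak_cvg (fun n => empirical (Z n (m n) w)) mu}.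
Proof.
(* Rational centres and radii suffice for the lattices of tents, and there are
   countably many of them. *)
have tents : {ae P, forall w, forall x : (int * int) * nat * nat,
    average R (Z n (m n) w)
      (fun v => truncated_log R (x.2.+1%:R^-1) (v - x.1.2.+1%:R^-1%:C%C * gauss R x.1.1)) -
    average R (Z n 0%N w)
      (fun v => truncated_log R (x.2.+1%:R^-1) (v - x.1.2.+1%:R^-1%:C%C * gauss R x.1.1))
      @[n --> \oo] --> (0 : R)}.
  apply: ae_forall_countable => x.
  by apply: (ae_average_truncated_log_cvg _ _ _ _ beta _ _ g); rewrite ?invr_gt0.
apply: filterS2 hmu tents => w wmu wt.
apply: (weak_cvg_from_tents R (fun n => Z n 0%N w) (fun n => Z n (m n) w) mu wmu).
by move=> k [//|N] [//|M] _ _; exact: (wt (k, N, M)).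
Qed.
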